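(* Let $\mathcal{X}$ and $\mathcal{Y}$ be Polish spaces, let $\mu_0$ be a probability measure on $\mathcal{X}$, let $\Gamma\ge 0$, and let $\mathcal{S}(\Gamma)=\{\mu\in\mathcal{M}_1(\mathcal{X}): D_{KL}(\mu\|\mu_0)\le\Gamma\}$. Let $Q$ be a conditional distribution from $\mathcal{X}$ to $\mathcal{Y}$ such that $I(X;Y)<\infty$ whenever $(X,Y)\sim\mu\otimes Q$ with $\mu\in\mathcal{S}(\Gamma)$. Then there exist a random variable $Z$ and a deterministic (measurable) function $g$ such that, for every $X\sim\mu$ with $\mu\in\mathcal{S}(\Gamma)$, $Z$ is independent of $X$, $Y$ can be expressed as $Y=g(X,Z)$ (i.e. $(X,g(X,Z))\sim\mu\otimes Q$), and $$H(Y\mid Z)\le \bar{I}(\mathcal{S}(\Gamma),Q)+\Gamma+\log\big(\bar{I}(\mathcal{S}(\Gamma),Q)+\Gamma+1\big)+4 .$$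
   Context: $\mathcal{M}_1(\mathcal{X})$ is the set of probability measures on $\mathcal{X}$ and $D_{KL}$ is the Kullback–Leibler divergence. A conditional distribution (stochastic kernel) $Q$ from $\mathcal{X}$ to $\mathcal{Y}$ is a map $x\mapsto Q(\cdot|x)$ into probability measures on $\mathcal{Y}$ with $x\mapsto Q(A|x)$ measurable for every measurable $A$. For $\mu\in\mathcal{M}_1(\mathcal{X})$, $\mu\otimes Q$ is the joint law of $(X,Y)$ with $X\sim\mu$, $Y|X=x\sim Q(\cdot|x)$; $I(\mu,Q)$ is the mutual information of this pair, and $\bar{I}(\mathcal{S},Q)=\sup_{\mu\in\mathcal{S}}I(\mu,Q)$. $H(\cdot\mid\cdot)$ is (discrete) conditional entropy; logarithms and entropies are in bits. *)

(* Defs.v *)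
From HB Require Import structures.
From mathcomp Require Import all_boot all_order all_algebra.
From mathcomp Require Import all_classical all_reals all_analysis.
Set Implicit Arguments. Unset Strict Implicit. Unset Printing Implicit Defensive.
Import Order.TTheory GRing.Theory Num.Theory.
Local Open Scope classical_set_scope.
Local Open Scope ring_scope.
Local Open Scope ereal_scope.

Section Defs.
Context {R : realType}.

Definition metric_open {T : Type} (dist : T -> T -> R) : set (set T) :=
  [set U | forall x, U x -> exists e : R, (0 < e)%R /\
                              forall y, (dist x y < e)%R -> U y].

Definition is_metric {T : Type} (dist : T -> T -> R) : Prop :=
  [/\ forall x y, dist x y = 0%R <-> x = y,
      forall x y, dist x y = dist y x &
      forall x y z, (dist x z <= dist x y + dist y z)%R].

Definition metric_complete {T : Type} (dist : T -> T -> R) : Prop :=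
  forall u : nat -> T,
    (forall e : R, (0 < e)%R -> exists N, forall m n, (N <= m)%N -> (N <= n)%N ->
        (dist (u m) (u n) < e)%R) ->
    exists x, forall e : R, (0 < e)%R -> exists N, forall n, (N <= n)%N ->
        (dist (u n) x < e)%R.

Definition metric_separable {T : Type} (dist : T -> T -> R) : Prop :=
  exists D : set T, countable D /\
    forall x (e : R), (0 < e)%R -> exists2 y, D y & (dist x y < e)%R.

Definition polish_borel {d} (T : measurableType d) : Prop :=
  exists dist : T -> T -> R,
    [/\ is_metric dist, metric_complete dist, metric_separable dist &
        (@measurable d T) = <<s metric_open dist >>].

Definition log2 (x : R) : R := (ln x / ln 2)%R.

Definition log2e (x : \bar R) : \bar R :=
  match x with
  | r%:E => (log2 r)%:E
  | +oo => +oo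
  | -oo => -oo
  end.

Definition kl_term (p q : \bar R) : \bar R :=
  if fine p == 0%R then 0
  else if fine q == 0%R then +oo
  else (fine p * log2 (fine p / fine q))%:E.

Definition finite_measurable_partition {d} {T : measurableType d}
   (n : nat) (F : nat -> set T) : Prop :=
  [/\ forall i, (i < n)%N -> measurable (F i),
      trivIset `I_n F & \bigcup_(i in `I_n) F i = setT].

(* D_KL(P || P0) := sup over finite measurable partitions (A_i) of
   sum_i P(A_i) log (P(A_i)/P0(A_i))   (Dobrushin/Gelfand-Yaglom-Perez) *)
Definition KL {d} {T : measurableType d} (P P0 : set T -> \bar R) : \bar R :=
  ereal_sup [set v | exists (n : nat) (F : nat -> set T),
     finite_measurable_partition n F /\
     v = \sum_(i < n) kl_term (P (F i)) (P0 (F i))].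

Definition joint {dX dY} {X : measurableType dX} {Y : measurableType dY}
  (mu : set X -> \bar R) (Q : X -> set Y -> \bar R) : set (X * Y) -> \bar R :=
  fun A => \int[mu]_x Q x (xsection A x).

Definition marginal {dX dY} {X : measurableType dX} {Y : measurableType dY}
  (mu : set X -> \bar R) (Q : X -> set Y -> \bar R) : set Y -> \bar R :=
  fun B => \int[mu]_x Q x B.

Definition prodm {dX dY} {X : measurableType dX} {Y : measurableType dY}
  (mu : set X -> \bar R) (nu : set Y -> \bar R) : set (X * Y) -> \bar R :=
  fun A => \int[mu]_x nu (xsection A x).

Definition MI {dX dY} {X : measurableType dX} {Y : measurableType dY}
  (mu : probability X R) (Q : R.-pker X ~> Y) : \bar R :=
  KL (joint mu (fun x B => Q x B)) (prodm mu (marginal mu (fun x B => Q x B))).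

Definition MIbar {dX dY} {X : measurableType dX} {Y : measurableType dY}
  (S : set (probability X R)) (Q : R.-pker X ~> Y) : \bar R :=
  ereal_sup [set MI mu Q | mu in S].

Definition KLball {d} {X : measurableType d} (mu0 : probability X R) (Gamma : R)
  : set (probability X R) :=
  [set mu | KL mu mu0 <= Gamma%:E].

Definition ent_term (p : \bar R) : \bar R := (- (fine p * log2 (fine p)))%:E.

(* Shannon entropy (bits) of a probability law P on Y: sum over atoms
   -P{y} log P{y} if P is discrete (its atoms carry all the mass),
   +oo otherwise. *)
Definition Hdisc {d} {Y : measurableType d} (P : set Y -> \bar R) : \bar R :=
  if (\esum_(y in [set: Y]) P [set y]) == 1 then
    \esum_(y in [set: Y]) ent_term (P [set y])
  else +oo.

(* H(Y | Z) for Y = g(X, Z), X ~ mu independent of Z ~ PZ: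
   the conditional law of Y given Z = z is the law of g(X, z). *)
Definition condH {dX dY dZ} {X : measurableType dX} {Y : measurableType dY}
  {Z : measurableType dZ} (mu : probability X R) (PZ : probability Z R)
  (g : X * Z -> Y) : \bar R :=
  \int[PZ]_z Hdisc (fun B => mu ((fun x => g (x, z)) @^-1` B)).

End Defs.

(* Main.v *)
Require Import Defs.
From HB Require Import structures.
From mathcomp Require Import all_boot all_order all_algebra.
From mathcomp Require Import finmap.
From mathcomp Require Import all_classical all_reals all_analysis.
From mathcomp Require Import measurable_realfun.
From mathcomp Require Import ring lra.
Set Implicit Arguments. Unset Strict Implicit. Unset Printing Implicit Defensive.
Import Order.TTheory GRing.Theory Num.Theory.
Import numFieldNormedType.Exports HBNNSimple.

(** Common randomness [z] is an iid sequence of candidates [(y_i, u_i)], with [y_i]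
    distributed as the output law [nu] of [Q] under [mu0] and [u_i] uniform. Finiteness of
    the mutual information under [mu0] gives a density [f] with [Q x = f (x, .) nu] for
    almost all [x], hence for all the inputs of the ball. Greedy rejection sampling then
    selects an index [K (x, z)] such that [y_K] has law [Q x].

    Given [z], the output is a function of [K], so a universal code for the integers
    bounds its entropy by [a + 1 + log2 (1 + a)] as soon as [E log2 (K + 1) <= a]. Given
    [x], [E ln (K + 1)] is at most [int f ln (1 + c f) dnu - ln c + 2 ln 2 - 1/2], which
    follows from [(i + 1) s_i <= tau_(i+1)], where [s_i] is the probability of reaching
    step [i] and [tau_i] the sum of the previous ones. Finally, the Donsker-Varadhan
    inequality, applied to the joint law against the product of its marginals and then to
    [mu] against [mu0], bounds the average over [x] of [int f ln (1 + c f) dnu] by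
    [(I (mu, Q) + KL mu mu0) ln 2 + ln (1 + c)]. *)

Local Open Scope classical_set_scope.
Local Open Scope ring_scope.
Local Open Scope ereal_scope.

(** The candidates follow the output law of [mu0], and not that of [mu], because [Z] and [g] must
    serve the whole ball. The price is explained by the chain rule: averaged over [mu], the
    divergence of [Q x] from [nu] is [I (mu, Q)] plus the divergence of the output law of [mu] from
    [nu], and data processing bounds the latter by [KL mu mu0 <= Gamma].

    Since [KL] is a supremum over finite partitions, neither the chain rule nor data processing is
    at hand as a formula on densities. A partition only yields lower bounds on [KL], so both facts
    are used in variational form, by exhibiting test functions. Nonnegative measurable test
    functions are limits of simple ones from below, which is why [ln (1 + c f)] stands for [ln f]
    and why truncations and shifts occur. The smoothing costs [ln (1 + c) - ln c], hence a large
    [c], here 20.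

    The other obstacle is that [K] must be small in logarithm, not in mean: a bound on [E (K + 1)]
    would involve the density itself and not its logarithm. *)

(** * Elementary inequalities on logarithms *)

Section real_inequalities.
Local Open Scope ring_scope.
Context {R : realType}.
Implicit Types a b c p q t v x : R.

Lemma ln_le_subr1 x : 0 < x -> ln x <= x - 1.
Proof. by move=> x0; rewrite -[X in ln X](subrKC 1) le_ln1Dx// ltrBrDl subrr. Qed.

(** The convex function [t * ln t] lies above its tangent at [q]. The weights need not sum to 1: the
    correction [p - q] accounts for the masses after summation. *)
Lemma gibbs_ineq p q : 0 <= p -> 0 < q -> p * ln q + p - q <= p * ln p.
Proof.
rewrite le_eqVlt => /predU1P[<- q0|p0 q0]; first by rewrite !mul0r add0r sub0r oppr_le0 ltW.
have qp : 0 < q / p by rewrite divr_gt0.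
have := ln_le_subr1 qp; rewrite ln_div ?posrE// => h.
have : p * (ln q - ln p) <= p * (q / p - 1) by rewrite ler_pM2l.
by rewrite mulrBr mulrBr mulr1 mulrCA divff ?gt_eqF// mulr1; lra.
Qed.

(** The function [(1 + t) * ln (1 + t) - t * ln t] has derivative [ln (1 + t^-1)], which decreases:
    over [[b, a]] it is at least its value at [a]. *)
Lemma ln1V_increment a b : 0 <= b -> b <= a -> 0 < a ->
  (a - b) * ln (1 + a^-1) <=
  ((1 + a) * ln (1 + a) - a * ln a) - ((1 + b) * ln (1 + b) - b * ln b).
Proof.
move=> b0 ba a0.
have -> : ln (1 + a^-1) = ln (1 + a) - ln a.
  rewrite -ln_div ?posrE ?addr_gt0//; congr ln.
  by rewrite mulrDl mul1r divff ?gt_eqF// addrC.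
have a1 : 0 < 1 + a by lra.
have b1 : 0 < 1 + b by lra.
(* With this ratio the corrections of the Gibbs inequalities at [(b, r * a)] and [(1, r)] cancel,
   since [r * a + r = 1 + b]. *)
set r := (1 + b) / (1 + a); have r0 : 0 < r by rewrite divr_gt0.
have lnr : ln r = ln (1 + b) - ln (1 + a) by rewrite ln_div ?posrE.
have h1 := gibbs_ineq b0 (mulr_gt0 r0 a0).
have h2 := gibbs_ineq (@ler01 R) r0.
rewrite lnM ?posrE// in h1; rewrite ln1 mulr0 mul1r in h2.
have er : r * a + r = 1 + b by rewrite /r; field; lra.
rewrite lnr in h1 h2; nra.
Qed.

(** The left side is [1 + a] times the entropy of a Bernoulli law of parameter [a / (1 + a)]. *)
Lemma binary_entropy_le a : 0 <= a -> (1 + a) * ln (1 + a) - a * ln a <= ln 2 * (1 + a).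
Proof.
move=> a0; have h0 : 0 < (1 + a) / 2 by lra.
have h1 := gibbs_ineq a0 h0; have h2 := gibbs_ineq (@ler01 R) h0.
have e : ln ((1 + a) / 2) = ln (1 + a) - ln 2 by rewrite ln_div// posrE; lra.
rewrite e in h1 h2; rewrite ln1 in h2; lra.
Qed.

(* [s i] is the probability of reaching step [i] and [tau i = s 0 + ... + s i.-1]. *)
Lemma greedy_log_index_le (s tau : nat -> R) N :
  s 0%N = 1 -> tau 0%N = 0 -> (forall i, tau i.+1 = tau i + s i) ->
  (forall i, 0 <= s i) -> (forall i, s i.+1 <= s i) ->
  \sum_(i < N) (s i - s i.+1) * ln (i.+1)%:R <=
  \sum_(i < N) (s i - s i.+1) * ln (tau i) + ln 2 * (1 + s 1%N).
Proof.
move=> s0 tau0 tauS s_ge0 s_dec.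
have le_tau i : i.+1%:R * s i <= tau i.+1.
  elim: i => [|i IHi]; first by rewrite tauS tau0 mul1r add0r.
  rewrite tauS -natr1 mulrDl mul1r lerD2r (le_trans _ IHi)// ler_wpM2l//.
have tau_ge1 i : 1 <= tau i.+1.
  elim: i => [|i IHi]; first by rewrite tauS tau0 s0 add0r.
  by rewrite tauS (le_trans IHi)// lerDl.
pose G a : R := (1 + a) * ln (1 + a) - a * ln a.
have G_ge0 a : 0 <= a -> 0 <= G a.
  move=> a0; rewrite /G; have [->|a0'] := eqVneq a 0.
    by rewrite addr0 ln1 !(mulr0, mul0r) subr0.
  have apos : 0 < a by rewrite lt0r a0' a0.
  have : ln a <= ln (1 + a) by rewrite ler_ln ?posrE; lra.
  have : 0 <= ln (1 + a) by rewrite ln_ge0; lra.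
  by nra.
(* From [le_tau] and [1 <= tau i.+1], the integer [i.+2] is at most [tau i.+1 * (1 + (s i.+1)^-1)].
   The logarithm of the second factor, weighted by the decrease of [s], is bounded by an increment
   of [G], and these telescope. *)
have step i : (s i.+1 - s i.+2) * ln (i.+2)%:R <=
    (s i.+1 - s i.+2) * ln (tau i.+1) + (G (s i.+1) - G (s i.+2)).
  have [si0|si0] := eqVneq (s i.+1) 0.
    have -> : s i.+2 = 0 by apply: le_anti; rewrite s_ge0 -si0 s_dec.
    by rewrite si0 !subrr !mul0r addr0.
  have spos : 0 < s i.+1 by rewrite lt0r si0 s_ge0.
  have := ln1V_increment (s_ge0 i.+2) (s_dec i.+1) spos; rewrite -!/(G _).
  have : ln (i.+2)%:R <= ln (tau i.+1) + ln (1 + (s i.+1)^-1).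
    have t1 := tau_ge1 i.
    have sV : 0 < (s i.+1)^-1 by rewrite invr_gt0.
    rewrite -lnM ?posrE; [|lra|lra].
    rewrite ler_ln ?posrE// ?mulr_gt0//; [|lra|lra].
    have := le_tau i.+1; rewrite tauS.
    rewrite -ler_pdivlMr// mulrDl divff// => h; apply: (le_trans h).
    by rewrite mulrDr mulr1 addrC lerD2r.
  have := s_dec i.+1; nra.
case: N => [|N].
  by rewrite !big_ord0 add0r mulr_ge0// ?addr_ge0// ln_ge0// ler1n.
(* The first term vanishes on both sides: [ln 1 = 0] on the left, the default value [ln 0 = 0] on
   the right. *)
rewrite !big_ord_recl tau0 ln1 ln0// !mulr0 !add0r /=.
apply: (@le_trans _ _ (\sum_(i < N) ((s i.+1 - s i.+2) * ln (tau i.+1) + (G (s i.+1) - G (s i.+2))))).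
  by apply: ler_sum => i _; exact: step.
rewrite big_split/= lerD2l.
have -> : \sum_(i < N) (G (s i.+1) - G (s i.+2)) = G (s 1%N) - G (s N.+1).
  elim: N => [|N IHN]; first by rewrite big_ord0 subrr.
  by rewrite big_ord_recr/= IHN; lra.
by rewrite (le_trans _ (binary_entropy_le (s_ge0 1%N)))// gerBl G_ge0.
Qed.

(** The sum is a lower Riemann sum of [ln] from 1 to [v], along the subdivision [tau] stopped at
    [v]; the right side is the value of that integral when [1 <= v], and 0 otherwise. The step from
    0 to 1 counts for nothing since [ln 0 = 0]. *)
Lemma truncated_log_sum_le (tau : nat -> R) v N :
  tau 0%N = 0 -> tau 1%N = 1 -> (forall i, tau i <= tau i.+1) -> 0 <= v ->
  \sum_(i < N) (Num.min v (tau i.+1) - Num.min v (tau i)) * ln (tau i) <=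
  Num.max 1 v * ln (Num.max 1 v) - Num.max 1 v + 1.
Proof.
move=> tau0 tau1 tauS v0.
have tau_ge1 i : 1 <= tau i.+1 by elim: i => [|i /le_trans]; [rewrite tau1|apply].
pose H b : R := b * ln b - b.
have Hinc a b : 1 <= a -> a <= b -> (b - a) * ln a <= H b - H a.
  by move=> a1 ab; have := @gibbs_ineq b a _ _; rewrite /H; nra.
have Hmono a b : 1 <= a -> a <= b -> H a <= H b.
  move=> a1 ab; have := Hinc a b a1 ab.
  by have : 0 <= ln a by [rewrite ln_ge0]; nra.
suff h : \sum_(i < N) (Num.min v (tau i.+1) - Num.min v (tau i)) * ln (tau i) <=
    H (Num.max 1 (Num.min v (tau N))) + 1.
  rewrite (le_trans h)// lerD2r; apply: Hmono; first by rewrite le_max lexx.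
  by rewrite ge_max !le_max !ge_min !lexx !orbT.
case: N => [|N].
  rewrite big_ord0 tau0 /H (min_idPr _)// (max_idPl _)// ln1; lra.
elim: N => [|N IHN].
  rewrite big_ord1 tau0 ln0// mulr0 tau1 (max_idPl _) ?ge_min ?lexx ?orbT// /H ln1; lra.
rewrite big_ord_recr/=; apply: (le_trans (lerD IHN (lexx _))).
rewrite addrAC lerD2r -lerBrDl.
have [vt|/ltW tv] := leP v (tau N.+1).
  by rewrite (min_idPl (le_trans vt (tauS _))) subrr mul0r subrr.
rewrite (max_idPr (tau_ge1 N)).
have tm : tau N.+1 <= Num.min v (tau N.+2) by rewrite le_min tv tauS.
by rewrite (max_idPr (le_trans (tau_ge1 N) tm)); apply: Hinc.
Qed.

(** The pointwise inequality to be integrated over the candidates. The summand [v] compensates the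
    [- v] of the integral of [ln]. The constant 1/2 comes from the Gibbs inequality at [(v, 1/2)]
    when [v <= 1]; when [1 <= v] it suffices that [1/2 <= ln 2]. *)
Lemma truncated_log_sum_bound (tau : nat -> R) v c N :
  tau 0%N = 0 -> tau 1%N = 1 -> (forall i, tau i <= tau i.+1) -> 0 <= v -> 0 < c ->
  \sum_(i < N) (Num.min v (tau i.+1) - Num.min v (tau i)) * ln (tau i)
    + ln 2 * (1 - Num.min v 1) + v * ln c + v
  <= v * ln (1 + c * v) + (ln 2 + 1 / 2).
Proof.
move=> tau0 tau1 tauS v0 c0.
have := @truncated_log_sum_le tau v N tau0 tau1 tauS v0.
set S := \sum_(i < N) _ => hS.
have ln2V : ln 2^-1 = - ln 2 :> R by rewrite lnV// posrE.
have l2 : 1 / 2 <= ln 2 :> R.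
  by have := @ln_le_subr1 2^-1 ltac:(by rewrite invr_gt0); rewrite ln2V; lra.
have [v_eq0|v_neq0] := eqVneq v 0.
  by rewrite v_eq0 in hS *; move: hS; rewrite (min_idPl _)// (max_idPl _)// ln1; lra.
have vpos : 0 < v by rewrite lt0r v_neq0 v0.
have : v * (ln c + ln v) <= v * ln (1 + c * v).
  rewrite ler_pM2l// -lnM ?posrE// ler_ln ?posrE ?mulr_gt0//; first by lra.
  by rewrite addr_gt0// mulr_gt0.
have [v1|/ltW v1] := leP v 1.
  move: hS; rewrite (max_idPl v1) ln1.
  by have := @gibbs_ineq v 2^-1 v0 ltac:(by rewrite invr_gt0); rewrite ln2V; lra.
by move: hS; rewrite (max_idPr v1); lra.
Qed.

(** Comparison with the integral of a power. Subtracting [t^-1] times the power [- t] of the last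
    integer, which is the integral of the tail, makes the bound provable by induction. *)
Lemma zeta_partial_sum_le t N : 0 < t ->
  \sum_(i < N) expR (- (1 + t) * ln i.+1%:R) <= 1 + t^-1 :> R.
Proof.
move=> t0.
suff h M : \sum_(i < M.+1) expR (- (1 + t) * ln i.+1%:R)
    <= 1 + t^-1 - t^-1 * expR (- t * ln M.+1%:R).
  have tV : 0 < t^-1 by rewrite invr_gt0.
  case: N => [|N]; first by rewrite big_ord0; lra.
  by apply: (le_trans (h N)); rewrite gerBl// mulr_ge0 ?expR_ge0 ?ltW.
elim: M => [|M IHM]; first by rewrite big_ord1 ln1 !mulr0 expR0; lra.
rewrite big_ord_recr/=; apply: (le_trans (lerD IHM (lexx _))).
set L := ln M.+2%:R; set L' := ln M.+1%:R.
have eL : expR (- L) = (M.+2%:R)^-1 by rewrite expRN lnK// posrE.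
have u_ge : expR (- L) <= L - L'.
  have : 0 < M.+1%:R / M.+2%:R :> R by rewrite divr_gt0.
  move=> /ln_le_subr1; rewrite ln_div ?posrE// -/L -/L' eL.
  have -> : M.+1%:R / M.+2%:R - 1 = - (M.+2%:R)^-1 :> R.
    have -> : M.+2%:R = M.+1%:R + 1 :> R by rewrite -natr1.
    have : 0 < M.+1%:R :> R by []; move: (M.+1%:R) => m m0; field; lra.
  by rewrite lerNr opprB.
have e1 : expR (- (1 + t) * L) = expR (- t * L) * expR (- L).
  by rewrite -expRD; congr expR; lra.
have e2 : expR (- t * L') = expR (- t * L) * expR (t * (L - L')).
  by rewrite -expRD; congr expR; lra.
have h : 1 + t * expR (- L) <= expR (t * (L - L')).
  by apply: le_trans (expR_ge1Dx _); rewrite lerD2l ler_pM2l.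
have key : t * expR (- (1 + t) * L) <= expR (- t * L') - expR (- t * L).
  rewrite e1 e2; have := expR_ge0 (- t * L); nra.
have : t^-1 * (t * expR (- (1 + t) * L)) <= t^-1 * (expR (- t * L') - expR (- t * L)).
  by rewrite ler_pM2l// invr_gt0.
by rewrite mulKf ?gt_eqF//; lra.
Qed.

(* The 8/5 bits cover the overhead of the sampler, [(2 ln 2 - 1/2 + 1/10) / ln 2], where
   1/10 absorbs the losses due to the truncations and to [ln (1 + c) - ln c]. *)
Lemma log2_numeric_bound (D : R) : 0 <= D ->
  D + 8 / 5 + 1 + log2 (1 + (D + 8 / 5)) <= D + log2 (D + 1) + 4.
Proof.
move=> D0; have l2 : 0 < ln 2 :> R by rewrite ln_gt0// ltr1n.
have log2K x : log2 x * ln 2 = ln x by rewrite /log2 divfK// gt_eqF.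
rewrite -(ler_pM2r l2) [leLHS]mulrDl [leRHS]mulrDl [in leRHS]mulrDl !log2K.
(* As [1 + (D + 8/5) <= 13/5 * (D + 1)], it remains to see that [(13/5)^5 <= 2^7]. Writing 13/5 as
   twice 13/10, this is [(13/10)^5 <= 4], obtained by rounding up the successive products 1.69, 2.89
   and 3.77. *)
suff : ln (1 + (D + 8 / 5)) * 5 <= ln (D + 1) * 5 + ln 2 * 7.
  by move: (ln (1 + (D + 8 / 5))) (ln (D + 1)) (ln 2) => a b c; nra.
have up a b c : 0 < a -> 0 < b -> a * b <= c -> ln a + ln b <= ln c :> R.
  move=> a0 b0 abc; have ab0 := mulr_gt0 a0 b0.
  by rewrite -lnM ?posrE// ler_ln ?posrE// (lt_le_trans ab0).
have down a b c : 0 < a -> 0 < b -> 0 < c -> c <= a * b -> ln c <= ln a + ln b :> R.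
  move=> a0 b0 c0 abc; have ab0 := mulr_gt0 a0 b0.
  by rewrite -lnM ?posrE// ler_ln ?posrE.
have h1 : ln (1 + (D + 8 / 5)) <= ln (13 / 5) + ln (D + 1) by apply: down; lra.
have h2 : ln (13 / 5) <= ln 2 + ln (13 / 10) :> R by apply: down; lra.
have h3 : ln (13 / 10) + ln (13 / 10) <= ln (17 / 10) :> R by apply: up; lra.
have h4 : ln (17 / 10) + ln (17 / 10) <= ln (29 / 10) :> R by apply: up; lra.
have h5 : ln (29 / 10) + ln (13 / 10) <= ln 4 :> R by apply: up; lra.
have h6 : ln 4 <= ln 2 + ln 2 :> R by apply: down; lra.
move: h1 h2 h3 h4 h5 h6; move: (ln (1 + (D + 8 / 5))) (ln (D + 1)) (ln 2) (ln (13 / 5)).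
by move: (ln (13 / 10)) (ln (17 / 10)) (ln (29 / 10)) (ln 4) => *; lra.
Qed.

End real_inequalities.

(** * The law of an infinite iid sequence *)

Section iid_sequence.
Context {R : realType} {d : measure_display} {W : measurableType d}.
Variable P : probability W R.

Definition coord_system : set (set (nat -> W)) :=
  [set A | exists j (B : set W), measurable B /\ A = (fun w => w j) @^-1` B].

Definition seqspace : Type := g_sigma_algebraType coord_system.
HB.instance Definition _ := Measurable.on seqspace.

Definition scons (p : W * seqspace) : seqspace :=
  fun n => if n is m.+1 then p.2 m else p.1.

Lemma measurable_coord j : measurable_fun [set: seqspace] (fun w : seqspace => w j).
Proof. by move=> _ B mB; rewrite setTI; apply: sub_sigma_algebra; exists j, B. Qed.

Lemma measurable_scons : measurable_fun [set: W * seqspace] scons.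
Proof.
apply: (@measurability _ _ _ seqspace _ _ coord_system) => //.
move=> _ [_ [j [B [mB ->]]] <-].
rewrite setTI; case: j => [|j].
  rewrite -[X in measurable X]setTI.
  exact: (@measurable_fst _ _ W seqspace).
rewrite -[X in measurable X]setTI.
by apply: (measurableT_comp (measurable_coord j) (@measurable_snd _ _ W seqspace)).
Qed.

HB.instance Definition _ := isMeasurableFun.Build _ _ _ _ scons measurable_scons.

(** Independent coordinates up to rank [n], followed by a fixed default tail. It is meaningful only
    on events decided by the first [n] coordinates. *)
Fixpoint prefix_law (n : nat) : probability seqspace R :=
  if n is m.+1 then distribution (P \x prefix_law m) scons
  else \d_(point : seqspace).

Lemma prefix_lawS n (A : set seqspace) :
  prefix_law n.+1 A = \int[P]_w prefix_law n ((fun z => scons (w, z)) @^-1` A).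
Proof.
rewrite /= /distribution /pushforward /product_measure1.
apply: eq_integral => w _ /=; congr (prefix_law n _).
by apply/seteqP; split => z /=; rewrite /xsection /= inE.
Qed.

Lemma measurable_scons_preimage w (A : set seqspace) : measurable A ->
  measurable ((fun z => scons (w, z)) @^-1` A).
Proof.
move=> mA; rewrite -[X in measurable X]setTI.
by apply: (measurableT_comp measurable_scons (measurable_pair1 w)).
Qed.

Lemma measurable_prefix_law_section n (A : set seqspace) : measurable A ->
  measurable_fun [set: W] (fun w => prefix_law n ((fun z => scons (w, z)) @^-1` A)).
Proof.
move=> mA; have mA' : measurable (scons @^-1` A).
  by rewrite -[X in measurable X]setTI; apply: measurable_scons.
have := @measurable_fun_xsection _ _ _ _ R (prefix_law n) _ mA'.
apply: eq_measurable_fun => w _ /=; congr (prefix_law n _).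
by apply/seteqP; split => z /=; rewrite /xsection /= inE.
Qed.

Definition depends_on_prefix n (A : set (nat -> W)) :=
  forall u v : nat -> W, (forall j, (j < n)%N -> u j = v j) -> A u -> A v.

Definition cylinder : set (set (nat -> W)) :=
  [set A | coord_system.-sigma.-measurable A /\ exists n, depends_on_prefix n A].

Lemma depends_on_prefix_le {n m A} : (n <= m)%N ->
  depends_on_prefix n A -> depends_on_prefix m A.
Proof. by move=> nm dA u v uv; apply: dA => j jn; apply: uv; exact: leq_trans nm. Qed.

Lemma depends_on_prefix_scons n (A : set seqspace) w : depends_on_prefix n.+1 A ->
  depends_on_prefix n ((fun z => scons (w, z)) @^-1` A).
Proof. by move=> dA u v uv; apply: dA => -[//|j]; exact: uv. Qed.

(** Recursion on the first coordinate. In the base case an event decided by no coordinate is empty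
    or full, so all probabilities agree on it. *)
Lemma prefix_law_stable n m (A : set seqspace) : measurable A ->
  depends_on_prefix n A -> (n <= m)%N -> prefix_law m A = prefix_law n A.
Proof.
elim: n m A => [|n IHn] m A mA dA nm.
  have [[u Au]|A0] := pselect (A !=set0).
    have -> : A = setT by apply/seteqP; split => // v _; apply: dA Au.
    by rewrite !probability_setT.
  have -> : A = set0 by apply/seteqP; split => // v Av; apply: A0; exists v.
  by rewrite !measure0.
case: m nm => [//|m]; rewrite ltnS => nm; rewrite !prefix_lawS.
apply: eq_integral => w _; apply: IHn => //; first exact: measurable_scons_preimage.
exact: depends_on_prefix_scons.
Qed.

Definition cylinder_space : Type := nat -> W.
HB.instance Definition _ := Pointed.on cylinder_space.

Lemma cylinder0 : cylinder set0.
Proof. by split; [exact: measurable0|exists 0%N]. Qed.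

Lemma cylinderU : setU_closed cylinder.
Proof.
move=> A B [mA [n dA]] [mB [m dB]]; split; first exact: measurableU.
exists (maxn n m) => u v uv [Au|Bu]; [left|right].
  by apply: dA Au => j jn; apply: uv; rewrite leq_max jn.
by apply: dB Bu => j jn; apply: uv; rewrite leq_max jn orbT.
Qed.

Lemma cylinderC : setC_closed cylinder.
Proof.
move=> A [mA [n dA]]; split; first exact: measurableC.
by exists n => u v uv Au Av; apply: Au; apply: dA Av => j jn; rewrite uv.
Qed.

(** An opaque name gives the algebra of cylinders a display of its own, apart from that of the
    product sigma-algebra on the same sequences. *)
Definition cylinder_display : measure_display. Proof. exact. Qed.

HB.instance Definition _ := @isAlgebraOfSets.Build cylinder_display cylinder_space
  cylinder cylinder0 cylinderU cylinderC.

(** Any length that decides [A] gives the same value, by [prefix_law_stable], so the choice of a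
    witness is harmless; 0 is a default value outside the algebra. *)
Definition cylinder_law (A : set cylinder_space) : \bar R :=
  if pselect (exists n, depends_on_prefix n A) is left e
  then prefix_law (projT1 (cid e)) A else 0.

Lemma cylinder_lawE n (A : set cylinder_space) : coord_system.-sigma.-measurable A ->
  depends_on_prefix n A -> cylinder_law A = prefix_law n A.
Proof.
move=> mA dA; rewrite /cylinder_law; case: pselect => [e|[]]; last by exists n.
case: cid => m dmA /=.
have [mn|/ltnW nm] := leqP m n; first exact/esym/prefix_law_stable.
exact/prefix_law_stable.
Qed.

Lemma cylinder_law_ge0 A : 0 <= cylinder_law A.
Proof. by rewrite /cylinder_law; case: pselect => // e; exact: measure_ge0. Qed.

Lemma cylinder_law0 : cylinder_law set0 = 0.
Proof. by rewrite (@cylinder_lawE 0%N) ?measure0. Qed.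

Lemma cylinder_law_additive : measure_function.semi_additive cylinder_law.
Proof.
apply/additive2P; first exact: cylinder_law0.
move=> A B [mA [n dA]] [mB [m dB]] AB0.
have [? dAB] : cylinder (A `|` B) by apply: cylinderU; split => //; [exists n|exists m].
have dA' := depends_on_prefix_le (leq_maxl n m) dA.
have dB' := depends_on_prefix_le (leq_maxr n m) dB.
rewrite (cylinder_lawE mA dA') (cylinder_lawE mB dB').
rewrite (@cylinder_lawE (maxn n m)) //; last first.
  by move=> u v uv [/dA'|/dB'] h; [left|right]; exact: h.
by rewrite measureU.
Qed.

HB.instance Definition _ := isContent.Build _ _ _ cylinder_law
  cylinder_law_ge0 cylinder_law_additive.

Lemma cylinder_section w (A : set cylinder_space) : cylinder A ->
  cylinder ((fun z => scons (w, z)) @^-1` A).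
Proof.
move=> [mA [n dA]]; split; first exact: measurable_scons_preimage.
by exists n; apply: depends_on_prefix_scons; exact: (depends_on_prefix_le (leqnSn n) dA).
Qed.

Lemma cylinder_law_section (A : set cylinder_space) : cylinder A ->
  cylinder_law A = \int[P]_w cylinder_law ((fun z => scons (w, z)) @^-1` A).
Proof.
move=> [mA [n dA]].
rewrite (cylinder_lawE mA (depends_on_prefix_le (leqnSn n) dA)) prefix_lawS.
apply: eq_integral => w _; rewrite (@cylinder_lawE n)//.
  exact: measurable_scons_preimage.
by apply: depends_on_prefix_scons; exact: (depends_on_prefix_le (leqnSn n) dA).
Qed.

Lemma measurable_cylinder_law_section (A : set cylinder_space) : cylinder A ->
  measurable_fun [set: W] (fun w => cylinder_law ((fun z => scons (w, z)) @^-1` A)).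
Proof.
move=> [mA [n dA]]; have := measurable_prefix_law_section n mA.
apply: eq_measurable_fun => w _; rewrite (@cylinder_lawE n)//.
  exact: measurable_scons_preimage.
by apply: depends_on_prefix_scons; exact: (depends_on_prefix_le (leqnSn n) dA).
Qed.

Definition prepend (u : nat -> W) (n : nat) (z : nat -> W) : nat -> W :=
  fun j => if (j < n)%N then u j else z (j - n)%N.

(** Once a prefix decides the event, its conditional probability is 0 or 1. *)
Lemma cylinder_law_prepend (A : set cylinder_space) u n : cylinder A ->
  depends_on_prefix n A -> cylinder_law (prepend u n @^-1` A) = (\1_A u)%:E.
Proof.
move=> [mA _] dA; have [Au|nAu] := boolP (u \in A); rewrite indicE ?Au ?(negbTE nAu).
  rewrite (_ : _ @^-1` _ = setT); last first.
    apply/seteqP; split => // z _ /=; move: Au; rewrite inE; apply: dA => j jn.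
    by rewrite /prepend jn.
  rewrite (@cylinder_lawE 0%N) ?probability_setT//.
rewrite (_ : _ @^-1` _ = set0) ?cylinder_law0//.
apply/seteqP; split => // z /= Az; move: nAu; rewrite notin_setE; apply.
by apply: dA Az => j jn; rewrite /prepend jn.
Qed.

(* If the covering inequality failed, integrating over the first coordinate would
   yield a value of it for which it still fails; repeating, one builds a sequence at
   which the finitely determined sets contradict the inclusion. *)
Lemma cylinder_law_sigma_subadditive : measurable_subset_sigma_subadditive cylinder_law.
Proof.
move=> A F mF mA AF; rewrite leNgt; apply/negP => lt.
pose bad (AF : set cylinder_space * (nat -> set cylinder_space)) :=
  [/\ cylinder AF.1, forall n, cylinder (AF.2 n) &
    \sum_(n <oo) cylinder_law (AF.2 n) < cylinder_law AF.1].
pose sec w (AF : set cylinder_space * (nat -> set cylinder_space)) :=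
  ((fun z => scons (w, z)) @^-1` AF.1, fun n => (fun z => scons (w, z)) @^-1` AF.2 n).
have step AF0 : exists w, bad AF0 -> bad (sec w AF0).
  have [bAF|] := pselect (bad AF0); last by exists point.
  case: bAF => mA0 mF0 lt0; apply: contrapT => /forallNP h.
  move: lt0; apply/negP; rewrite -leNgt cylinder_law_section//.
  rewrite (eq_eseriesr (fun n _ => cylinder_law_section (mF0 n))).
  rewrite -integral_nneseries//; last by move=> n; exact: measurable_cylinder_law_section.
  apply: ge0_le_integral => //.
  - exact: measurable_cylinder_law_section.
  - by apply: ge0_emeasurable_sum => // n _; exact: measurable_cylinder_law_section.
  - move=> w _; rewrite leNgt; apply/negP => ltw; apply: (h w) => _; split => //=.
      exact: cylinder_section.
    by move=> n; exact: cylinder_section.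
have [nextw nextwP] := choice step.
pose st := fix st n := if n is m.+1 then sec (nextw (st m)) (st m) else (A, F).
have stbad n : bad (st n) by elim: n => [|n IHn] /=; [split|exact: nextwP].
pose u n := nextw (st n).
have preS n (B : set cylinder_space) :
    prepend u n.+1 @^-1` B =
    (fun z => scons (u n, z)) @^-1` (prepend u n @^-1` B).
  suff e z : prepend u n.+1 z = prepend u n (scons (u n, z)).
    by apply/seteqP; split => z; rewrite /preimage /= e.
  apply/funext => j; rewrite /prepend ltnS; case: ltngtP => [//|jn|->].
    by rewrite -[(j - n)%N]prednK ?subn_gt0//= subnS.
  by rewrite subnn.
have stE n : st n = (prepend u n @^-1` A, fun k => prepend u n @^-1` F k).
  elim: n => [|n IHn].
    by rewrite /=; congr pair; [|apply/funext => k]; apply/seteqP; split => z /=;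
      rewrite /prepend /= (_ : (fun j => z (j - 0)%N) = z)//; apply/funext => j; rewrite subn0.
  rewrite [LHS]/= -/(u n) IHn /sec /= preS; congr pair.
  by apply/funext => k; rewrite preS.
have lawle (B : set cylinder_space) : cylinder B -> cylinder_law B <= 1.
  by move=> [mB [n dB]]; rewrite (cylinder_lawE mB dB) probability_le1.
(* At a length that decides [A], the section of [A] has law 0 or 1, and 0 cannot strictly exceed a
   sum of nonnegative terms. *)
have Au : A u.
  have [n dA] := mA.2; have [_ _] := stbad n; rewrite stE /= cylinder_law_prepend//.
  have [//|nAu] := pselect (A u); rewrite indicE memNset//= ltNge => /negP[].
  by apply: nneseries_ge0 => *; exact: cylinder_law_ge0.
(* At a length that decides [F k], the section of [F k] alone already has law 1, which contradicts
   the strict inequality. *)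
have [k _ Fku] := AF _ Au.
have [n dF] := (mF k).2; have [mAn mFn] := stbad n; apply/negP; rewrite -leNgt.
apply: (le_trans (lawle _ mAn)); rewrite stE /=.
have -> : 1%E = cylinder_law (prepend u n @^-1` F k).
  by rewrite (cylinder_law_prepend u (mF k) dF) indicE mem_set.
rewrite (nneseriesD1 (n := k))//.
by rewrite leeDl// nneseries_ge0 => // *; exact: cylinder_law_ge0.
Qed.

HB.instance Definition _ := Content_SigmaSubAdditive_isMeasure.Build _ _ _
  cylinder_law cylinder_law_sigma_subadditive.


Definition iid_space : Type := g_sigma_algebraType (@measurable _ cylinder_space).
HB.instance Definition _ := Measurable.on iid_space.

Definition iid_law : set iid_space -> \bar R := measure_extension cylinder_law.
HB.instance Definition _ := Measure.on iid_law.

Lemma iid_law_cylinder (A : set iid_space) : cylinder A -> iid_law A = cylinder_law A.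
Proof. by move=> cA; exact: (measurable_mu_extE cylinder_law). Qed.

Lemma iid_law_setT : iid_law setT = 1.
Proof.
rewrite iid_law_cylinder; last exact: (@measurableT _ cylinder_space).
by rewrite (@cylinder_lawE 0%N) ?probability_setT.
Qed.

HB.instance Definition _ := @Measure_isProbability.Build _ _ R iid_law iid_law_setT.

Lemma cylinder_coord j (B : set W) : measurable B ->
  cylinder ((fun w : nat -> W => w j) @^-1` B).
Proof.
move=> mB; split; first by apply: sub_sigma_algebra; exists j, B.
by exists j.+1 => u v uv /=; rewrite uv.
Qed.

Lemma measurable_iid_coord j : measurable_fun [set: iid_space] (fun w : iid_space => w j).
Proof. by move=> _ B mB; rewrite setTI; apply: sub_sigma_algebra; exact: cylinder_coord. Qed.

(** The form in which independence and the common law enter the analysis of the sampler: a run of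
    rejections followed by an acceptance is a box. *)
Lemma iid_law_box n (A : nat -> set W) : (forall j, measurable (A j)) ->
  iid_law [set w | forall j, (j < n)%N -> A j (w j)] = \prod_(j < n) P (A j).
Proof.
move=> mA; pose box m (B : nat -> set W) : set seqspace :=
  [set w | forall j, (j < m)%N -> B j (w j)].
have mbox m B : (forall j, measurable (B j)) -> measurable (box m B).
  move=> mB; rewrite (_ : box m B = \bigcap_j
      (if (j < m)%N then (fun w : seqspace => w j) @^-1` B j else setT)).
    apply: bigcapT_measurable => j; case: ifP => // _.
    by rewrite -[X in measurable X]setTI; exact: measurable_coord.
  apply/seteqP; split => w /= wB j => [_|jm]; first by case: ifPn => // /wB.
  by have := wB j I; rewrite jm.
have dbox m B : depends_on_prefix m (box m B).
  by move=> u v uv uB j jm; rewrite -uv//; exact: uB.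
rewrite iid_law_cylinder; last by split; [exact: mbox|exists n; exact: dbox].
rewrite (cylinder_lawE (mbox n A mA) (dbox n A)).
elim: n A mA => [|n IHn] A mA.
  by rewrite big_ord0 (_ : box _ _ = setT) ?probability_setT//; apply/seteqP.
rewrite prefix_lawS big_ord_recl.
under eq_integral => w _.
  rewrite (_ : _ @^-1` _ = if w \in A 0%N then box n (fun j => A j.+1) else set0).
    over.
  apply/seteqP; split => z; rewrite /preimage /=.
    move=> zA; rewrite mem_set; last exact: (zA 0%N).
    by move=> j jn; exact: (zA j.+1).
  by case: ifPn => [/set_mem wA zA [//|j] jn|//]; exact: zA.
rewrite (eq_integral (fun w => (\1_(A 0%N) w)%:E *
    prefix_law n (box n (fun j => A j.+1)))); last first.
  by move=> w _; rewrite indicE; case: ifPn => _; rewrite ?measure0 ?mul1e ?mul0e.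
rewrite ge0_integralZr//; last first.
  by apply/measurable_EFinP; exact: measurable_indic.
by rewrite integral_indic// setIT IHn.
Qed.


End iid_sequence.

(** * Entropy of a function of an integer index *)

Section discrete_entropy.
Context {R : realType}.

Lemma esum_fibers {T : choiceType} (y : nat -> T) (a : nat -> \bar R) :
  (forall i, 0 <= a i) ->
  \esum_(t in [set: T]) \esum_(i in [set i | y i = t]) a i = \sum_(i <oo) a i.
Proof.
move=> a0; rewrite esum_esum//= nneseries_esumT//.
rewrite (@reindex_esum _ _ _ [set: nat] _ (fun i => (y i, i)))//.
split => [i _ //=|i j _ _ [] //|[t i] /= [_ <-]]; by exists i.
Qed.

Lemma esum_fiber_scale {T : choiceType} (y : nat -> T) (a : nat -> \bar R) (c : T -> R) t :
  (forall i, 0 <= a i) -> (forall i, (0 <= c (y i))%R) ->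
  ((c t)%:E * (\esum_(i in [set i | y i = t]) a i) =
  \esum_(i in [set i | y i = t]) ((c (y i))%:E * a i))%E.
Proof.
move=> a0 c0; have set_asbool : [set i | y i = t] = [set i | `[< y i = t >]].
  by apply/seteqP; split => i /= /asboolP.
rewrite set_asbool -!nneseries_esum//; last first.
  by move=> i _; rewrite mule_ge0// lee_fin.
by rewrite -nneseriesZl//; apply: eq_eseriesr => i /asboolP ->.
Qed.

Context {d : measure_display} {T : measurableType d} {d' : measure_display}
  {Y : measurableType d'}.

(** Two facts at once. Merging the indices with the same image by [y] only enlarges atoms, hence
    shortens ideal code lengths; and the entropy of the index is at most its cross entropy against a
    subprobability [q]. *)
Lemma Hdisc_le_cross_entropy (mu : probability T R) (K : T -> nat) (y : nat -> Y)
    (q : nat -> R) :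
  (forall i, measurable (K @^-1` [set i])) ->
  (forall i, 0 < q i <= 1)%R -> (forall N, \sum_(i < N) q i <= 1)%R ->
  Hdisc (fun B => mu ((fun x => y (K x)) @^-1` B)) <=
  \sum_(i <oo) mu (K @^-1` [set i]) * (- log2 (q i))%:E.
Proof.
move=> mK q01 sumq.
pose k i := mu (K @^-1` [set i]).
pose P t := mu ((fun x => y (K x)) @^-1` [set t]).
have k0 i : 0 <= k i by exact: measure_ge0.
have tK D : trivIset D (fun i => K @^-1` [set i]).
  by move=> i j _ _ [x [/= -> ->]].
have PE t : P t = \esum_(i in [set i | y i = t]) k i.
  have -> : [set i | y i = t] = [set i | `[< y i = t >]].
    by apply/seteqP; split => i /= /asboolP.
  rewrite -nneseries_esum// /P.
  rewrite (_ : _ @^-1` _ = \bigcup_(i in [set i | `[< y i = t >]]) (K @^-1` [set i])); last first.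
    apply/seteqP; split => [x /= <-|x [i /= /asboolP <- <-//]].
    by exists (K x) => //=; exact/asboolP.
  by rewrite measure_bigcup//; apply: eq_eseriesl => i; apply/idP/idP => [/set_mem//|?]; exact/mem_set.
have sumk : \sum_(i <oo) k i = 1.
  rewrite -(@probability_setT _ _ _ mu) (_ : setT = \bigcup_i (K @^-1` [set i])).
    by rewrite measure_bigcup//; apply: eq_eseriesl => i; rewrite in_setT.
  by apply/seteqP; split => // x _; exists (K x).
pose p t := fine (P t).
have mP t : measurable ((fun x => y (K x)) @^-1` [set t]).
  rewrite (_ : _ @^-1` _ = \bigcup_(i in [set i | y i = t]) (K @^-1` [set i])).
    by apply: bigcup_measurable => i _; exact: mK.
  by apply/seteqP; split => [x /= <-|x [i /= <- <-//]]; exists (K x).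
have pE t : P t = (p t)%:E by rewrite /p fineK// fin_num_measure.
have p_le1 t : (p t <= 1)%R by rewrite -lee_fin -pE probability_le1.
have p_ge0 t : (0 <= p t)%R by rewrite -lee_fin -pE measure_ge0.
have k_le i : k i <= P (y i).
  by rewrite le_measure ?inE// => x /= ->.
have kE i : k i = (fine (k i))%:E by rewrite fineK// fin_num_measure.
have ln2 : (0 < ln 2 :> R)%R by rewrite ln_gt0// ltr1n.
have log2_le0 (x : R) : (x <= 1)%R -> (0 <= - log2 x)%R.
  by move=> x1; rewrite /log2 -mulNr divr_ge0 ?(ltW ln2)// oppr_ge0 ln_le0.
(* Summing over the fibers of [y] shows that the atoms carry all the mass, and turns the entropy
   into a series over indices, where each index pays the ideal code length of its whole atom. *)
have -> : Hdisc (fun B => mu ((fun x => y (K x)) @^-1` B)) =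
    \sum_(i <oo) (- log2 (p (y i)))%:E * k i.
  rewrite /Hdisc; under eq_esum do rewrite -/(P _) PE.
  rewrite esum_fibers// sumk eqxx.
  rewrite -(esum_fibers y); last by move=> i; rewrite mule_ge0// lee_fin log2_le0.
  apply: eq_esum => t _; rewrite -/(P t) /ent_term.
  rewrite -(esum_fiber_scale (c := fun t => (- log2 (p t))%R))// -?PE ?pE; last first.
    by move=> i; rewrite log2_le0.
  by rewrite -EFinM -/(p t) mulrC mulNr.
pose c : R := (ln 2)^-1%R; have c0 : (0 < c)%R by rewrite invr_gt0.
(* The corrections [c * k i] and [c * q i] stay on opposite sides so that all series have
   nonnegative terms. They sum to [c] and to at most [c]; the factor [c] converts nats to bits. *)
have step i : (- log2 (p (y i)))%:E * k i + c%:E * k i <=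
    k i * (- log2 (q i))%:E + c%:E * (q i)%:E.
  have := k_le i; rewrite pE kE -!EFinM -!EFinD !lee_fin.
  have : (0 <= fine (k i))%R by rewrite fine_ge0.
  move: (fine (k i)) (p (y i)) => a b; rewrite le_eqVlt => /predU1P[<- _|a0 ab].
    rewrite !(mul0r, mulr0) !addr0 add0r mulr_ge0 ?(ltW c0)//.
    by have /andP[/ltW] := q01 i.
  have /andP[q0 _] := q01 i.
  have g := gibbs_ineq (ltW a0) q0.
  have lab : (ln a <= ln b)%R by rewrite ler_ln ?posrE// (lt_le_trans a0).
  have h : (- ln b * a + a <= a * - ln (q i) + q i)%R by nra.
  rewrite /log2 -/c (_ : _ + _ = (- ln b * a + a) * c)%R; last by ring.
  rewrite [leRHS](_ : _ = (a * - ln (q i) + q i) * c)%R; last by ring.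
  by rewrite ler_pM2r.
have sumcq : \sum_(i <oo) c%:E * (q i)%:E <= c%:E.
  rewrite nneseriesZl; last by move=> i _; rewrite lee_fin; have /andP[/ltW] := q01 i.
  rewrite -[leRHS]mule1 lee_pmul2l//; apply: lime_le.
    by apply: is_cvg_nneseries => i _ _; rewrite lee_fin; have /andP[/ltW] := q01 i.
  by apply: nearW => n; rewrite sumEFin lee_fin big_mkord.
have q1 i : (q i <= 1)%R by have /andP[] := q01 i.
have q0 i : (0 <= q i)%R by have /andP[/ltW] := q01 i.
rewrite -(leeD2rE (x := c%:E))//.
apply: (@le_trans _ _ (\sum_(i <oo) ((- log2 (p (y i)))%:E * k i + c%:E * k i))).
  rewrite nneseriesD; last 2 first.
    by move=> i _ _; rewrite mule_ge0// lee_fin log2_le0.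
    by move=> i _ _; rewrite mule_ge0// lee_fin ltW.
  by rewrite [in X in _ <= _ + X]nneseriesZl// sumk mule1.
apply: (@le_trans _ _ (\sum_(i <oo) (k i * (- log2 (q i))%:E + c%:E * (q i)%:E))).
  apply: lee_nneseries => // i _ _.
  by rewrite adde_ge0// mule_ge0// lee_fin ?log2_le0// ltW.
rewrite nneseriesD; last 2 first.
  by move=> i _ _; rewrite mule_ge0// lee_fin log2_le0.
  by move=> i _ _; rewrite -EFinM lee_fin mulr_ge0// ltW.
by rewrite leeD2l.
Qed.

End discrete_entropy.

(** * Variational bounds on the divergence *)

Section kullback_leibler.
Context {R : realType} {d : measure_display} {T : measurableType d}.

Lemma ln2_gt0 : (0 < ln 2 :> R)%R. Proof. by rewrite ln_gt0// ltr1n. Qed.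

Lemma finite_measurable_partitionC (A : set T) : measurable A ->
  finite_measurable_partition 2 (fun i => if i == 0%N then A else ~` A).
Proof.
move=> mA; split.
- by case=> [|[|i]]//= _; exact: measurableC.
- move=> [|[|i]] [|[|j]]//= _ _ [x []] //; by move=> ? /(_ _).
- apply/seteqP; split => // x _; have [Ax|nAx] := pselect (A x).
    by exists 0%N.
  by exists 1%N.
Qed.

Lemma kl_term_gtNy (p q : \bar R) : kl_term p q != -oo.
Proof. by rewrite /kl_term; case: ifP => // _; case: ifP. Qed.

(** In the partition into [A] and its complement, the cell [A] would contribute [+oo]. *)
Lemma KL_dominates (P P0 : probability T R) (A : set T) : KL P P0 < +oo -> measurable A ->
  P0 A = 0 -> P A = 0.
Proof.
move=> KLoo mA P0A; apply/eqP; apply: contraLR KLoo => PA0.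
rewrite -leNgt leye_eq -leye_eq; apply: ereal_sup_ubound.
exists 2%N, (fun i => if i == 0%N then A else ~` A); split.
  exact: finite_measurable_partitionC.
rewrite !big_ord_recl big_ord0/= adde0 [in X in _ = X + _]/kl_term P0A eqxx.
rewrite ifF; first by rewrite addye// kl_term_gtNy.
apply/negbTE; apply: contra PA0 => /eqP fPA.
by rewrite -(@fineK _ (P A)) ?fin_num_measure// fPA.
Qed.

Lemma KL_ge0 (P P0 : probability T R) : 0 <= KL P P0.
Proof.
apply: ereal_sup_ubound; exists 1%N, (fun=> setT); split.
  split => //; first by move=> [|i] [|j].
  by apply/seteqP; split => // x _; exists 0%N.
rewrite big_ord1 !probability_setT /kl_term /= oner_eq0 divr1 /log2 ln1 mul0r.
by rewrite mulr0.
Qed.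

Lemma KL_refl_le0 (P : probability T R) : KL P P <= 0.
Proof.
apply: ge_ereal_sup => _ [n [F [_ ->]]]; apply: sume_le0 => i _.
rewrite /kl_term; case: ifPn => // p0.
by rewrite (negbTE p0) divff// /log2 ln1 mul0r mulr0.
Qed.

(** The Gibbs inequality against the tilted mass [q * expR r / C]: this is the contribution of one
    cell to the Donsker-Varadhan inequality. *)
Lemma kl_term_ge (p q C r : R) : (0 <= p)%R -> (0 <= q)%R -> (0 < C)%R ->
  ((p * r - p * ln C + p - q * expR r / C) / ln 2)%:E <= kl_term p%:E q%:E.
Proof.
move=> p0 q0 C0; rewrite /kl_term /=.
have qrC : (0 <= q * expR r / C)%R by rewrite divr_ge0// ?(ltW C0)// mulr_ge0// expR_ge0.
have [->|pn0] := eqVneq p 0%R.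
  rewrite lee_fin !mul0r subrr add0r sub0r mulNr oppr_le0.
  by rewrite divr_ge0// ltW// ln2_gt0.
have [->|qn0] := eqVneq q 0%R; first exact: leey.
have ppos : (0 < p)%R by rewrite lt0r pn0 p0.
have qpos : (0 < q)%R by rewrite lt0r qn0 q0.
rewrite lee_fin /log2 mulrA ler_pM2r ?invr_gt0 ?ln2_gt0//.
have qe : (0 < q * expR r)%R by rewrite mulr_gt0 ?expR_gt0.
have := gibbs_ineq p0 (divr_gt0 qe C0).
rewrite !ln_div ?posrE// lnM ?posrE ?expR_gt0// expRK => ?; lra.
Qed.

Lemma integral_partition (P : {measure set T -> \bar R}) n (F : nat -> set T)
    (c : nat -> R) (h : T -> R) :
  finite_measurable_partition n F -> (forall x, 0 <= h x)%R ->
  measurable_fun setT h -> (forall i x, (i < n)%N -> F i x -> h x = c i) ->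
  \int[P]_x (h x)%:E = \sum_(i < n) (c i)%:E * P (F i).
Proof.
move=> [mF tF UF] h0 mh hc.
have mF' (i : 'I_n) : measurable (F i) by exact: mF.
rewrite -UF bigcup_mkord ge0_integral_bigsetU//=.
- apply: eq_bigr => i _.
  rewrite (eq_integral (cst (c i)%:E)); first by rewrite integral_cst.
  by move=> x /[!inE] Fix; rewrite (hc i x).
- exact: index_enum_uniq.
- by move=> i j _ _ [x [Fi Fj]]; apply/val_inj; apply: tF => //=; exists x.
- by apply: measurable_funTS; exact/measurable_EFinP.
- by move=> x _; rewrite lee_fin.
Qed.

(** The level sets of a simple function form a partition that competes in the supremum defining
    [KL]. The factor [ln 2] appears because [KL] is in bits. *)
Lemma donsker_varadhan_nnsfun (P P0 : probability T R) (h : {nnsfun T >-> R}) (C : R) : (0 < C)%R ->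
  \int[P0]_x (expR (h x))%:E <= C%:E ->
  \int[P]_x (h x)%:E <= KL P P0 * (ln 2)%:E + (ln C)%:E.
Proof.
move=> C0 hC.
pose s : seq R := fset_set (range h); pose n := size s.
pose c i := nth 0%R s i; pose F i := h @^-1` [set c i].
have partF : finite_measurable_partition n F.
  split.
  - by move=> i _; exact: measurable_sfunP.
  - move=> i j /= ni nj [x [/= hi hj]]; apply/eqP.
    by rewrite -(nth_uniq 0%R ni nj (fset_uniq (fset_set (range h)))) -/(c i) -/(c j) -hi -hj.
  - apply/seteqP; split => // x _.
    have hx : h x \in s by rewrite in_fset_set// inE; exists x.
    by exists (index (h x) s); [rewrite /= index_mem|rewrite /F /= /c nth_index].
have mh : measurable_fun setT h by exact: measurable_funPT.
have eP : \int[P]_x (h x)%:E = \sum_(i < n) (c i)%:E * P (F i).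
  by apply: integral_partition => // i x _.
have eP0 : \int[P0]_x (expR (h x))%:E = \sum_(i < n) (expR (c i))%:E * P0 (F i).
  apply: (integral_partition P0 (c := fun i => expR (c i)) (h := fun x => expR (h x)) partF).
    by move=> x; exact: expR_ge0.
    exact: (measurableT_comp (@measurable_expR R) mh).
  by move=> i x _ ->.
rewrite eP; rewrite eP0 in hC.
have fP i : (i < n)%N -> P (F i) = (fine (P (F i)))%:E.
  by move=> ni; have [mF _ _] := partF; rewrite fineK// fin_num_measure//; exact: mF.
have fP0 i : (i < n)%N -> P0 (F i) = (fine (P0 (F i)))%:E.
  by move=> ni; have [mF _ _] := partF; rewrite fineK// fin_num_measure//; exact: mF.
have sumP : \sum_(i < n) P (F i) = 1.
  have := integral_partition P (c := cst 1%R) (h := cst 1%R) partF.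
  under eq_bigr do rewrite mul1e.
  by move=> <-//; rewrite [LHS](integral_cst P measurableT 1) mul1e; exact: probability_setT.
pose p i := fine (P (F i)); pose w i := fine (P0 (F i)).
have : ((\sum_(i < n) (p i * c i - p i * ln C + p i - w i * expR (c i) / C)) / ln 2)%:E <= KL P P0.
  apply: (@le_trans _ _ (\sum_(i < n) kl_term (P (F i)) (P0 (F i)))); last first.
    by apply: ereal_sup_ubound; exists n, F.
  rewrite mulr_suml -sumEFin; apply: lee_sum => i _.
  by rewrite fP// fP0// kl_term_ge ?fine_ge0.
move=> /(lee_wpmul2r (x := (ln 2)%:E)); rewrite lee_fin (ltW ln2_gt0) => /(_ isT) KLge.
rewrite -leeBlDr//; apply: le_trans KLge.
rewrite -EFinM divfK ?gt_eqF ?ln2_gt0//.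
under eq_bigr do rewrite fP// -EFinM mulrC -/(p _).
rewrite sumEFin -EFinB lee_fin.
rewrite big_split/= sumrN !big_split/= sumrN -!mulr_suml.
have -> : (\sum_(i < n) p i = 1)%R.
  by apply: EFin_inj; rewrite -sumP -sumEFin; apply: eq_bigr => i _; rewrite fP.
have hC' : (\sum_(i < n) w i * expR (c i) <= C)%R.
  rewrite -lee_fin -sumEFin; apply: le_trans hC; apply: lee_sum => i _.
  by rewrite fP0// -EFinM lee_fin mulrC lexx.
have : ((\sum_(i < n) w i * expR (c i)) / C <= 1)%R by rewrite ler_pdivrMr// mul1r.
lra.
Qed.

(** The integral of a nonnegative [f] is the supremum over simple functions below it, and lowering
    [f] keeps the exponential moment under [C]. *)
Lemma donsker_varadhan (P P0 : probability T R) (f : T -> R) (C : R) : (0 < C)%R ->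
  measurable_fun setT f -> (forall x, 0 <= f x)%R ->
  \int[P0]_x (expR (f x))%:E <= C%:E ->
  \int[P]_x (f x)%:E <= KL P P0 * (ln 2)%:E + (ln C)%:E.
Proof.
move=> C0 mf f0 fC; rewrite ge0_integralTE//.
apply: ge_ereal_sup => _ [h /= hf <-].
have -> : sintegral P h = \int[P]_x (h x)%:E.
  by rewrite integralT_nnsfun.
apply: donsker_varadhan_nnsfun => //; apply: le_trans fC.
apply: ge0_le_integral => //.
- by apply/measurable_EFinP; apply: (measurableT_comp (@measurable_expR R)).
- by apply/measurable_EFinP; apply: (measurableT_comp (@measurable_expR R)).
- by move=> x _; rewrite lee_fin ler_expR -lee_fin; exact: hf.
Qed.

End kullback_leibler.

(** * Joint and output laws as probability measures *)

Section joint_law.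
Context {R : realType} {dX dY : measure_display} {X : measurableType dX}
  {Y : measurableType dY}.
Variables (mu : probability X R) (Q : R.-pker X ~> Y).

Definition joint_law : set (X * Y) -> \bar R := joint mu (fun x B => Q x B).
Definition marginal_law : set Y -> \bar R := marginal mu (fun x B => Q x B).

Lemma measurable_kernel_xsection (A : set (X * Y)) : measurable A ->
  measurable_fun [set: X] (fun x => Q x (xsection A x)).
Proof. by move=> mA; apply: measurable_fun_xsection_finite_kernel; rewrite inE. Qed.

Let joint0 : joint_law set0 = 0.
Proof. by apply: integral0_eq => x _; rewrite xsection0 measure0. Qed.

Let joint_ge0 A : 0 <= joint_law A.
Proof. by apply: integral_ge0 => x _; exact: measure_ge0. Qed.

Let joint_sigma_additive : semi_sigma_additive joint_law.
Proof.
move=> F mF tF mUF.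
rewrite [X in _ --> X](_ : _ = \sum_(n <oo) joint_law (F n)).
  by apply/cvg_closeP; split; [exact: is_cvg_nneseries|rewrite closeE].
rewrite -integral_nneseries//; last by move=> n; exact: measurable_kernel_xsection.
apply: eq_integral => x _; apply/esym/cvg_lim => //=; rewrite xsection_bigcup.
apply: (measure_sigma_additive _ (trivIset_xsection tF)) => ?.
exact: measurable_xsection.
Qed.

HB.instance Definition _ := isMeasure.Build _ _ _ joint_law
  joint0 joint_ge0 joint_sigma_additive.

Let joint_setT : joint_law setT = 1.
Proof.
rewrite /joint_law /joint (eq_integral (cst 1)).
  by rewrite integral_cst//= mul1e probability_setT.
move=> x _; rewrite (_ : xsection _ _ = setT) ?prob_kernel//.
by apply/seteqP; split => // y _; rewrite /xsection /= in_setT.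
Qed.

HB.instance Definition _ := @Measure_isProbability.Build _ _ R joint_law joint_setT.

Lemma marginal_lawE (B : set Y) : marginal_law B = joint_law (setT `*` B).
Proof.
apply: eq_integral => x _; congr (Q x _); apply/seteqP.
by split => y; rewrite /xsection /= inE /=; [|case].
Qed.

Let marginal0 : marginal_law set0 = 0.
Proof. by rewrite marginal_lawE setX0 measure0. Qed.

Let marginal_ge0 B : 0 <= marginal_law B.
Proof. by rewrite marginal_lawE measure_ge0. Qed.

Let marginal_sigma_additive : semi_sigma_additive marginal_law.
Proof.
move=> F mF tF mUF; rewrite marginal_lawE setX_bigcupr.
under eq_fun do under eq_bigr do rewrite marginal_lawE.
apply: measure_semi_sigma_additive.
- by move=> n; exact: measurableX.
- by move=> i j _ _ [[x y] [[_ Fi] [_ Fj]]]; apply: tF => //; exists y.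
- by rewrite -setX_bigcupr; exact: measurableX.
Qed.

HB.instance Definition _ := isMeasure.Build _ _ _ marginal_law
  marginal0 marginal_ge0 marginal_sigma_additive.

Let marginal_setT : marginal_law setT = 1.
Proof. by rewrite marginal_lawE setXTT probability_setT. Qed.

HB.instance Definition _ := @Measure_isProbability.Build _ _ R marginal_law marginal_setT.

End joint_law.

(** * Integration against densities *)

Section density.
Context {R : realType} {d : measure_display} {T : measurableType d}.

Lemma ae_eq_dominated (mu0 mu : {measure set T -> \bar R}) (f g : T -> \bar R) :
  (forall N, measurable N -> mu0 N = 0 -> mu N = 0) ->
  ae_eq mu0 setT f g -> ae_eq mu setT f g.
Proof. by move=> dom [N [mN N0 sub]]; exists N; split => //; exact: dom. Qed.

(** The function [f] and the Radon-Nikodym derivative have the same integral over every measurable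
    set, hence agree almost everywhere, and change of variables carries over to [f]. *)
Lemma ge0_integral_density (lam : {sigma_finite_measure set T -> \bar R})
    (J : {finite_measure set T -> \bar R}) (f k : T -> \bar R) :
  (forall x, 0 <= f x) -> measurable_fun setT f ->
  (forall A, measurable A -> J A = \int[lam]_(x in A) f x) ->
  (forall x, 0 <= k x) -> measurable_fun setT k ->
  \int[J]_x k x = \int[lam]_x (k x * f x).
Proof.
move=> f0 mf fJ k0 mk.
have dom : J `<< lam.
  apply/null_content_dominatesP => A mA lamA; rewrite fJ//.
  by apply: null_set_integral => //; exact: measurable_funTS.
rewrite -(Radon_Nikodym_SigmaFinite.change_of_variables dom)//.
apply: ae_eq_integral => //.
- apply: emeasurable_funM => //.
  exact: (measurable_int _ (Radon_Nikodym_SigmaFinite.f_integrable dom)).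
- exact: emeasurable_funM.
- apply: ae_eqe_mul2l; apply: integral_ae_eq => //.
    exact: Radon_Nikodym_SigmaFinite.f_integrable.
  by move=> E _ mE; rewrite -fJ// -Radon_Nikodym_SigmaFinite.f_integral.
Qed.

(** Integrals of nonnegative functions are suprema over simple functions, hence monotone. This
    serves for [Hdisc] as a function of the common randomness, whose measurability is not
    established. *)
Lemma le_integral_nonmeasurable (mu : {measure set T -> \bar R}) (f g : T -> \bar R) :
  (forall x, 0 <= g x) -> (forall x, f x <= g x) -> \int[mu]_x f x <= \int[mu]_x g x.
Proof.
move=> g0 fg; rewrite integralE.
apply: (@le_trans _ _ (\int[mu]_x f^\+ x)).
  by rewrite geeDl// oppe_le0 integral_ge0.
rewrite !ge0_integralTE//; apply: ge_ereal_sup => _ [h /= hf <-].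
apply: ereal_sup_ubound; exists h => //= x; apply: (le_trans (hf x)).
by rewrite funeposE ge_max fg g0.
Qed.

End density.

(** * A density of the kernel with respect to the output law *)

Section joint_density.
Context {R : realType} {dX dY : measure_display} {X : measurableType dX}
  {Y : measurableType dY}.
Variables (mu0 : probability X R) (Q : R.-pker X ~> Y).
Local Notation nu := (marginal_law mu0 Q).

(** Take the density of the joint law under [mu0] with respect to the product and disintegrate it.
    The identity for the sections holds outside a [mu0]-null set of inputs, which is also [mu]-null:
    one [f] serves every dominated [mu]. *)
Lemma joint_density :
  (forall A, measurable A -> (mu0 \x nu) A = 0 -> joint_law mu0 Q A = 0) ->
  exists f : X * Y -> R, [/\ measurable_fun setT f, (forall p, 0 <= f p)%R,
    (forall x, \int[nu]_y (f (x, y))%:E = 1) &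
    forall mu : probability X R,
      (forall N, measurable N -> mu0 N = 0 -> mu N = 0) ->
      forall A, measurable A ->
        joint_law mu Q A = \int[mu]_x \int[nu]_y ((f (x, y))%:E * (\1_A (x, y))%:E)].
Proof.
move=> dom.
pose lam : probability (X * Y)%type R := mu0 \x nu.
pose J : probability (X * Y)%type R := joint_law mu0 Q.
have Jlam : J `<< lam by exact/null_content_dominatesP.
have [g0 [g0_ge0 g0_fin g0_int g0E]] := radon_nikodym_sigma_finite Jlam.
have mg0 : measurable_fun setT g0 by exact: measurable_int g0_int.
pose f1 p := fine (g0 p).
have f1E p : (f1 p)%:E = g0 p by rewrite fineK.
have f1_ge0 p : (0 <= f1 p)%R by rewrite -lee_fin f1E.
have mf1 : measurable_fun setT f1 by apply: measurableT_comp.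
pose sec (A : set (X * Y)) x := \int[nu]_y ((f1 (x, y))%:E * (\1_A (x, y))%:E).
have mfA (A : set (X * Y)) : measurable A ->
    measurable_fun setT (fun p => (f1 p)%:E * (\1_A p)%:E).
  move=> mA; apply: emeasurable_funM; first exact/measurable_EFinP.
  by apply/measurable_EFinP; exact: measurable_indic.
have fA_ge0 (A : set (X * Y)) p : 0 <= (f1 p)%:E * (\1_A p)%:E.
  by rewrite mule_ge0// lee_fin.
have msec A : measurable A -> measurable_fun setT (sec A).
  move=> mA; exact: (measurable_fun_fubini_tonelli_F (m2 := nu) _ (mfA A mA) (fA_ge0 A)).
have secE A : measurable A -> joint_law mu0 Q A = \int[mu0]_x sec A x.
  move=> mA; rewrite g0E// integral_mkcond.
  rewrite (eq_integral (fun p => (f1 p)%:E * (\1_A p)%:E)).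
    exact: (fubini_tonelli1 _ (mfA A mA) (fA_ge0 A)).
  by move=> p _; rewrite epatch_indic f1E.
have secI A E : measurable A -> measurable E ->
    \int[mu0]_(x in E) sec A x = joint_law mu0 Q (A `&` (E `*` setT)).
  move=> mA mE; rewrite secE; last by apply: measurableI => //; exact: measurableX.
  rewrite integral_mkcond; apply: eq_integral => x _; rewrite patchE.
  case: ifPn => xE.
    apply: eq_integral => y _; rewrite indicI /= [X in _ = _ * (_ * X)%:E]indicE.
    by rewrite mem_set ?mulr1//; split => //; move: xE; rewrite inE.
  rewrite /sec integral0_eq// => y _; rewrite indicI /= [X in _ * (_ * X)%:E]indicE.
  by rewrite memNset ?mulr0 ?mule0// => -[/= Ex _]; move: xE; rewrite mem_set.
(* Both sides have the same integral over every set of inputs. The null set may depend on [A], which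
   is harmless because [A] is fixed before integrating in [x]. *)
have sec_ae A : measurable A ->
    ae_eq mu0 setT (fun x => Q x (xsection A x)) (sec A).
  move=> mA; apply: integral_ae_eq => //.
  - apply/integrableP; split; first exact: measurable_kernel_xsection.
    under eq_integral do rewrite gee0_abs//.
    by rewrite -[ltLHS]/(joint_law mu0 Q A) ltey_eq fin_num_measure.
  - exact: msec.
  - move=> E _ mE; rewrite secI// /joint_law /joint [LHS]integral_mkcond.
    apply: eq_integral => x _; rewrite patchE; case: ifPn => xE.
      congr (Q x _); apply/seteqP; split => y; rewrite /xsection /= !inE/=.
        by move=> Axy; do 2 split => //; move: xE; rewrite inE.
      by case.
    rewrite (_ : xsection _ _ = set0) ?measure0//; apply/seteqP; split => // y.
    by rewrite /xsection /= inE => -[_ [/= Ex _]]; move: xE; rewrite mem_set.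
(* [f1] is replaced by 1 above the null set of [x] at which it is not a probability
   density, so that the sampler is well defined for every [x] *)
pose f p := if sec setT p.1 == 1 then f1 p else 1%R.
have f1T x : \int[nu]_y (f1 (x, y))%:E = sec setT x.
  by apply: eq_integral => y _; rewrite indicT mule1.
have mf : measurable_fun setT f.
  apply: measurable_fun_ifT => //.
  apply: measurable_fun_eqe => //.
  exact: (measurableT_comp (msec _ measurableT) (@measurable_fst _ _ X Y)).
have f_ge0 p : (0 <= f p)%R by rewrite /f; case: ifP.
exists f; split => //.
- move=> x; rewrite /f /=; have [e1|_] := eqVneq (sec setT x) 1; first by rewrite f1T.
  by rewrite integral_cst//= mul1e probability_setT.
- move=> mu mu_dom A mA.
  have aeT : ae_eq mu setT (cst 1) (sec setT).
    apply: (ae_eq_dominated mu_dom).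
    apply: filterS (sec_ae setT measurableT) => x /[apply] <- /=.
    rewrite (_ : xsection _ _ = setT) ?prob_kernel//.
    by apply/seteqP; split => // y _; rewrite /xsection /= in_setT.
  apply: ae_eq_integral => //.
  + exact: measurable_kernel_xsection.
  + apply: (measurable_fun_fubini_tonelli_F (m2 := nu)
      (fun p => (f p)%:E * (\1_A p)%:E)).
      apply: emeasurable_funM; first exact/measurable_EFinP.
      by apply/measurable_EFinP; exact: measurable_indic.
    by move=> p; rewrite mule_ge0// lee_fin.
  + apply: filterS2 aeT (ae_eq_dominated mu_dom (sec_ae A mA)) => x h1 h2 xT.
    rewrite h2//; apply: eq_integral => y _; rewrite /f /=.
    by have /= <- := h1 xT; rewrite eqxx.
Qed.

End joint_density.

(** * The uniform law on the unit interval *)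

Section uniform_itv.
Context {R : realType}.

(* [uniform_prob] lives on the alias [measurableTypeR R] of the measurable type [R]. *)
Definition id_measurableTypeR : measurableTypeR R -> R := idfun.

Lemma measurable_id_measurableTypeR :
  measurable_fun [set: measurableTypeR R] id_measurableTypeR.
Proof. exact: (@measurable_id _ _ setT). Qed.

HB.instance Definition _ := isMeasurableFun.Build _ _ _ _
  id_measurableTypeR measurable_id_measurableTypeR.

Definition unif01 : probability R R :=
  distribution (uniform_prob (@ltr01 R)) id_measurableTypeR.

Lemma unif01_lt (c : R) : unif01 [set u | (u < c)%R] = (Num.max 0 (Num.min c 1))%:E.
Proof.
rewrite /unif01 /= /distribution /pushforward /uniform_prob integral_uniform_pdf.
rewrite (eq_integral (cst 1)); last first.
  move=> x; rewrite inE => -[_ /=]; rewrite in_itv/= /uniform_pdf => ->.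
  by rewrite subr0 invr1.
have [c0|c0] := leP c 0%R.
  rewrite (_ : _ `&` _ = set0) ?integral_set0.
    by rewrite (max_idPl _)// ge_min c0.
  apply/seteqP; split => // x [/= xc]; rewrite in_itv/= => /andP[x0 _].
  by have := lt_le_trans (le_lt_trans x0 xc) c0; rewrite ltxx.
have [c1|c1] := leP c 1%R.
  rewrite (_ : _ `&` _ = `[0%R, c[%classic); last first.
    apply/seteqP; split => x /=; rewrite !in_itv/=.
      by move=> [-> /andP[-> _]].
    by move=> /andP[-> xc]; split => //; exact: le_trans (ltW xc) c1.
  rewrite integral_cst//= lebesgue_measure_itv/= lte_fin c0 mul1e oppr0 adde0.
  by rewrite (max_idPr (ltW c0)).
rewrite (_ : _ `&` _ = `[0%R, 1%R]%classic); last first.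
  apply/seteqP; split => x /=; rewrite !in_itv/=; first by case.
  by move=> /andP[-> x1]; split => //; exact: le_lt_trans x1 c1.
rewrite integral_cst//= lebesgue_measure_itv/= lte_fin ltr01 mul1e oppr0 adde0.
by rewrite (max_idPr ler01).
Qed.

End uniform_itv.

(** * Greedy rejection sampling of a density *)

Section greedy_rejection.
Context {R : realType} {d : measure_display} {Y : measurableType d}.
Variables (nu : probability Y R) (v : Y -> R).

(* Candidate [(y, u)] of rank [n] is accepted when [gtau n + gsurv n * u < v y]. The
   increments of [gtau] are chosen so that [gsurv n] is the probability of reaching rank
   [n], and the mass output there has density [gband n], the part of [v] lying between
   the heights [gtau n] and [gtau n.+1]. *)
Definition trunc_mass (t : R) : R := fine (\int[nu]_y (Num.min (v y) t)%:E).

Fixpoint gtau (n : nat) : R :=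
  if n is m.+1 then (gtau m + (1 - trunc_mass (gtau m)))%R else 0%R.

Definition gsurv (n : nat) : R := (1 - trunc_mass (gtau n))%R.

Definition gband (n : nat) (y : Y) : R :=
  (Num.min (v y) (gtau n.+1) - Num.min (v y) (gtau n))%R.

Definition gaccept (n : nat) : set (Y * R) :=
  [set p | (gtau n + gsurv n * p.2 < v p.1)%R].

Hypothesis mv : measurable_fun setT v.
Hypothesis v0 : forall y, (0 <= v y)%R.
Hypothesis v1 : \int[nu]_y (v y)%:E = 1.

Lemma measurable_trunc t : measurable_fun setT (fun y => Num.min (v y) t).
Proof. exact: measurable_minr. Qed.
Hint Resolve measurable_trunc : core.

Lemma integral_trunc t : (0 <= t)%R ->
  \int[nu]_y (Num.min (v y) t)%:E = (trunc_mass t)%:E.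
Proof.
move=> t0; rewrite /trunc_mass fineK// ge0_fin_numE; last first.
  by apply: integral_ge0 => y _; rewrite lee_fin le_min v0.
apply: (@le_lt_trans _ _ (\int[nu]_y (v y)%:E)); last by rewrite v1 ltry.
apply: ge0_le_integral => //.
- by move=> y _; rewrite lee_fin le_min v0.
- exact/measurable_EFinP.
- exact/measurable_EFinP.
- by move=> y _; rewrite lee_fin ge_min lexx.
Qed.

Lemma trunc_mass_le1 t : (0 <= t)%R -> (trunc_mass t <= 1)%R.
Proof.
move=> t0; rewrite -lee_fin -integral_trunc// -[leRHS]v1.
apply: ge0_le_integral => //.
- by move=> y _; rewrite lee_fin le_min v0.
- exact/measurable_EFinP.
- exact/measurable_EFinP.
- by move=> y _; rewrite lee_fin ge_min lexx.
Qed.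

Lemma trunc_mass_mono t t' : (0 <= t)%R -> (t <= t')%R -> (trunc_mass t <= trunc_mass t')%R.
Proof.
move=> t0 tt'; rewrite -lee_fin -!integral_trunc//; last exact: le_trans tt'.
apply: ge0_le_integral => //.
- by move=> y _; rewrite lee_fin le_min v0.
- exact/measurable_EFinP.
- exact/measurable_EFinP.
- by move=> y _; rewrite lee_fin le_min !ge_min lexx tt' orbT.
Qed.

Lemma gtau_ge0 n : (0 <= gtau n)%R.
Proof.
by elim: n => //= n IHn; rewrite addr_ge0// subr_ge0 trunc_mass_le1.
Qed.
Hint Resolve gtau_ge0 : core.

Lemma gsurv_ge0 n : (0 <= gsurv n)%R.
Proof. by rewrite subr_ge0 trunc_mass_le1. Qed.
Hint Resolve gsurv_ge0 : core.

Lemma gtauS n : gtau n.+1 = (gtau n + gsurv n)%R. Proof. by []. Qed.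

Lemma gtau_le n : (gtau n <= gtau n.+1)%R.
Proof. by rewrite gtauS lerDl. Qed.

Lemma gsurv_le n : (gsurv n.+1 <= gsurv n)%R.
Proof. by rewrite lerD2l lerN2 trunc_mass_mono// gtau_le. Qed.

Lemma gsurv0 : gsurv 0 = 1%R.
Proof.
rewrite /gsurv /trunc_mass /= (eq_integral (cst 0)) ?integral0 ?subr0//.
by move=> y _; rewrite (min_idPr (v0 y)).
Qed.

Lemma gtau1 : gtau 1 = 1%R.
Proof. by rewrite gtauS gsurv0 add0r. Qed.

Lemma gband_ge0 n y : (0 <= gband n y)%R.
Proof. by rewrite subr_ge0 le_min !ge_min lexx gtau_le orbT. Qed.
Hint Resolve gband_ge0 : core.

Lemma measurable_gband n : measurable_fun setT (gband n).
Proof. by apply: measurable_funB. Qed.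
Hint Resolve measurable_gband : core.

Lemma integral_gband n : \int[nu]_y (gband n y)%:E = (gsurv n - gsurv n.+1)%:E.
Proof.
have : \int[nu]_y (Num.min (v y) (gtau n.+1))%:E =
    \int[nu]_y (Num.min (v y) (gtau n))%:E + \int[nu]_y (gband n y)%:E.
  rewrite -ge0_integralD//.
  - by apply: eq_integral => y _; rewrite -EFinD /gband addrC subrK.
  - by move=> y _; rewrite lee_fin le_min v0 gtau_ge0.
  - exact/measurable_EFinP.
  - by move=> y _; rewrite lee_fin.
  - exact/measurable_EFinP.
rewrite !integral_trunc// => /eqP; rewrite addeC -sube_eq//; last first.
  by rewrite fin_num_adde_defl.
by move=> /eqP <-; rewrite -EFinB; congr EFin; rewrite /gsurv; lra.
Qed.

Lemma integral_gband_sum_le (B : set Y) n : measurable B ->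
  \sum_(i < n) \int[nu]_(y in B) (gband i y)%:E <= \int[nu]_(y in B) (v y)%:E.
Proof.
move=> mB; rewrite -ge0_integral_sum//; last 2 first.
  by move=> i; exact/measurable_EFinP/measurable_funTS.
  by move=> i y _; rewrite lee_fin.
apply: ge0_le_integral => //.
- by move=> y _; apply: sume_ge0 => i _; rewrite lee_fin.
- by apply: emeasurable_sum => i; exact/measurable_EFinP/measurable_funTS.
- exact/measurable_EFinP/measurable_funTS.
- move=> y _; rewrite sumEFin lee_fin.
  suff -> : (\sum_(i < n) gband i y = Num.min (v y) (gtau n))%R by rewrite ge_min lexx.
  elim: n => [|n IHn]; first by rewrite big_ord0 (min_idPr (v0 y)).
  by rewrite big_ord_recr/= IHn /gband addrC subrK.
Qed.

(** If all survival probabilities were at least [e], then [gtau n] would be at least [n * e]. The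
    truncations of [v] at these heights increase to [v], so their masses would tend to 1 while
    staying below [1 - e]. *)
Lemma gsurv_lt (e : R) : (0 < e)%R -> exists n, (gsurv n < e)%R.
Proof.
move=> e0; apply: contrapT => /forallNP h.
have {}h n : (e <= gsurv n)%R by rewrite leNgt; apply/negP/h.
have tauge n : (n%:R * e <= gtau n)%R.
  elim: n => [|n IHn]; first by rewrite mul0r.
  by rewrite gtauS -natr1 mulrDl mul1r lerD.
pose g n y := (Num.min (v y) (n%:R * e))%:E.
have e_ge0 n : (0 <= n%:R * e)%R by rewrite mulr_ge0// ltW.
have : \int[nu]_y (v y)%:E <= (1 - e)%:E.
  have -> : \int[nu]_y (v y)%:E = \int[nu]_y limn (g ^~ y).
    apply: eq_integral => y _; apply/esym/lim_near_cst => //.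
    near=> n; rewrite /g (min_idPl _)//.
    rewrite -ler_pdivrMr//; near: n; exact: nbhs_infty_ger.
  rewrite monotone_convergence//.
  - apply: lime_le.
      apply: ereal_nondecreasing_is_cvgn => m n mn; apply: ge0_le_integral => //.
      + by move=> y _; rewrite lee_fin le_min v0 e_ge0.
      + exact/measurable_EFinP.
      + exact/measurable_EFinP.
      + move=> y _; rewrite lee_fin le_min !ge_min lexx/= ler_pM2r// ler_nat mn.
        by rewrite orbT.
    apply: nearW => n; rewrite integral_trunc// lee_fin.
    rewrite (le_trans (trunc_mass_mono _ (tauge n)))//.
    by have := h n; rewrite /gsurv; lra.
  - by move=> n; exact/measurable_EFinP.
  - by move=> n y _; rewrite lee_fin le_min v0 e_ge0.
  - move=> y _ m n mn; rewrite lee_fin le_min !ge_min lexx/= ler_pM2r// ler_nat mn.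
    by rewrite orbT.
by rewrite v1 lee_fin; lra.
Unshelve. all: end_near. Qed.

Lemma integral_EFinD (a b : Y -> R) (A B : R) :
  measurable_fun setT a -> measurable_fun setT b ->
  (forall y, 0 <= a y)%R -> (forall y, 0 <= b y)%R ->
  \int[nu]_y (a y)%:E = A%:E -> \int[nu]_y (b y)%:E = B%:E ->
  \int[nu]_y (a y + b y)%:E = (A + B)%:E.
Proof.
move=> ma mb a0 b0 aA bB; rewrite EFinD -aA -bB -ge0_integralD//.
- by move=> y _; rewrite lee_fin.
- exact/measurable_EFinP.
- by move=> y _; rewrite lee_fin.
- exact/measurable_EFinP.
Qed.

Lemma integral_EFinM (a : Y -> R) (A k : R) :
  measurable_fun setT a -> (forall y, 0 <= a y)%R -> (0 <= k)%R ->
  \int[nu]_y (a y)%:E = A%:E -> \int[nu]_y (a y * k)%:E = (A * k)%:E.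
Proof.
move=> ma a0 k0 aA; rewrite EFinM -aA -ge0_integralZr//.
- exact/measurable_EFinP.
- by move=> y _; rewrite lee_fin.
Qed.

(** Integrating [truncated_log_sum_bound] and adding [greedy_log_index_le] gives the constant
    [(ln 2 + 1/2) + ln 2 - 1], where the 1 is the mass of [v]. Taking [1 <= c] keeps [v * ln c]
    nonnegative. *)
Lemma gsurv_log_bound c N : (1 <= c)%R ->
  (\sum_(i < N) (gsurv i - gsurv i.+1) * ln i.+1%:R + ln c)%:E <=
  \int[nu]_y (v y * ln (1 + c * v y))%:E + (2 * ln 2 - 1 / 2)%:E.
Proof.
move=> c1; have c0 : (0 < c)%R by lra.
pose S := (\sum_(i < N) (gsurv i - gsurv i.+1) * ln (gtau i))%R.
have lntau i : (0 <= ln (gtau i))%R.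
  case: i => [|i]; first by rewrite ln0.
  rewrite ln_ge0//; elim: i => [|i IHi]; first by rewrite gtau1.
  exact: le_trans (gtau_le _).
have lnc : (0 <= ln c)%R by rewrite ln_ge0.
have ln2 := @ln2_gt0 R.
(* The left side of [truncated_log_sum_bound] at [v y]: a sum of nonnegative terms, each with an
   explicit integral. *)
pose h y : R := (\sum_(i < N) gband i y * ln (gtau i) +
  ln 2 * (1 - Num.min (v y) 1) + v y * ln c + v y)%R.
have h1_ge0 y : (0 <= 1 - Num.min (v y) 1)%R by rewrite subr_ge0 ge_min lexx orbT.
have m1 : measurable_fun setT (fun y => 1 - Num.min (v y) 1)%R by apply: measurable_funB.
pose band_log M y := (\sum_(i < M) gband i y * ln (gtau i))%R.
have band_log_ge0 M y : (0 <= band_log M y)%R.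
  by apply: sumr_ge0 => i _; rewrite mulr_ge0.
have m_band_log M : measurable_fun setT (band_log M).
  elim: M => [|M IHM].
    by rewrite (_ : band_log 0%N = cst 0%R)//; apply/funext => y; rewrite /band_log big_ord0.
  rewrite (_ : band_log _ = (fun y => band_log M y + gband M y * ln (gtau M))%R).
    by apply: measurable_funD => //; apply: measurable_funM.
  by apply/funext => y; rewrite /band_log big_ord_recr.
have int_band_log M : \int[nu]_y (band_log M y)%:E =
    (\sum_(i < M) (gsurv i - gsurv i.+1) * ln (gtau i))%:E.
  elim: M => [|M IHM].
    by rewrite big_ord0 integral0_eq// => y _; rewrite /band_log big_ord0.
  rewrite big_ord_recr /= -(integral_EFinD (a := band_log M)
    (b := fun y => (gband M y * ln (gtau M))%R)) //.
  - by apply: eq_integral => y _; rewrite /band_log big_ord_recr.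
  - by apply: measurable_funM.
  - by move=> y; rewrite mulr_ge0.
  - by apply: integral_EFinM => //; exact: integral_gband.
have int1 : \int[nu]_y (1 - Num.min (v y) 1)%:E = (gsurv 1)%:E.
  have : \int[nu]_y (1 - Num.min (v y) 1 + Num.min (v y) 1)%:E = 1.
    by under eq_integral do rewrite subrK; rewrite [LHS](integral_cst nu measurableT 1) mul1e; exact: probability_setT.
  under eq_integral do rewrite EFinD.
  rewrite ge0_integralD//; last 4 first.
    by move=> y _; rewrite lee_fin.
    exact/measurable_EFinP.
    by move=> y _; rewrite lee_fin le_min v0 ler01.
    exact/measurable_EFinP.
  rewrite integral_trunc// => /esym/eqP; rewrite -sube_eq//; last by rewrite fin_num_adde_defl.
  by move=> /eqP <-; rewrite -EFinB /gsurv gtau1.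
pose u2 y := ((1 - Num.min (v y) 1) * ln 2)%R; pose u3 y := (v y * ln c)%R.
have m2 : measurable_fun setT u2 by apply: measurable_funM.
have m3 : measurable_fun setT u3 by apply: measurable_funM.
have u2_ge0 y : (0 <= u2 y)%R by rewrite mulr_ge0// ltW.
have u3_ge0 y : (0 <= u3 y)%R by rewrite mulr_ge0.
have m12 := measurable_funD (m_band_log N) m2.
have m123 := measurable_funD m12 m3.
have u12_ge0 y : (0 <= band_log N y + u2 y)%R by rewrite addr_ge0// band_log_ge0.
have u123_ge0 y : (0 <= band_log N y + u2 y + u3 y)%R by rewrite addr_ge0.
have hE y : h y = (band_log N y + u2 y + u3 y + v y)%R by rewrite /h /u2 [(ln 2 * _)%R]mulrC.
have mh : measurable_fun setT h.
  by rewrite (_ : h = (fun y => band_log N y + u2 y + u3 y + v y)%R); [exact: measurable_funD m123 mv|exact/funext].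
have int_h : \int[nu]_y (h y)%:E = (S + ln 2 * gsurv 1 + ln c + 1)%:E.
  under eq_integral do rewrite hE.
  apply: (integral_EFinD m123 mv u123_ge0 v0 _ v1).
  apply: (integral_EFinD m12 m3 u12_ge0 u3_ge0).
    apply: (integral_EFinD (m_band_log N) m2 (band_log_ge0 N) u2_ge0 (int_band_log N)).
    by rewrite mulrC; apply: integral_EFinM => //; exact: ltW.
  by have := integral_EFinM mv v0 lnc v1; rewrite mul1r.
have hle y : (h y <= v y * ln (1 + c * v y) + (ln 2 + 1 / 2))%R.
  exact: (truncated_log_sum_bound N erefl gtau1 gtau_le (v0 y) c0).
have h0 y : (0 <= h y)%R by rewrite hE addr_ge0.
have vl0 y : (0 <= v y * ln (1 + c * v y))%R.
  by rewrite mulr_ge0// ln_ge0// lerDl mulr_ge0// ltW.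
have mvl : measurable_fun setT (fun y => v y * ln (1 + c * v y))%R.
  apply: measurable_funM => //; apply: (measurableT_comp (@measurable_ln R)).
  by apply: measurable_funD => //; apply: measurable_funM.
have : \int[nu]_y (h y)%:E <=
    \int[nu]_y (v y * ln (1 + c * v y))%:E + (ln 2 + 1 / 2)%:E.
  rewrite [X in _ <= _ + X](_ : _ = \int[nu]_y (cst (ln 2 + 1 / 2)%R y)%:E); last first.
    by rewrite [RHS](integral_cst nu measurableT (ln 2 + 1 / 2)%:E) [X in _ * X](_ : _ = 1) ?mule1//; exact: probability_setT.
  have l20 : (0 <= ln 2 + 1 / 2 :> R)%R by lra.
  rewrite -ge0_integralD//.
  - apply: ge0_le_integral => //.
    + by move=> y _; rewrite lee_fin.
    + exact/measurable_EFinP.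
    + by apply: emeasurable_funD; apply/measurable_EFinP.
    + by move=> y _; rewrite -EFinD lee_fin hle.
  - by move=> y _; rewrite lee_fin.
  - exact/measurable_EFinP.
  - exact/measurable_EFinP.
rewrite int_h => int_le.
have gl := greedy_log_index_le N gsurv0 erefl gtauS gsurv_ge0 gsurv_le.
rewrite -(leeD2rE (x := (1 + ln 2 * gsurv 1)%:E))// -addeA -!EFinD.
apply: (@le_trans _ _ ((S + ln 2 * gsurv 1 + ln c + 1)%:E + (ln 2 * (1 + gsurv 1))%:E)).
  by rewrite -EFinD lee_fin; rewrite -/S in gl; lra.
apply: (le_trans (leeD2r _ int_le)); rewrite -addeA -EFinD leeD2l// lee_fin; lra.
Qed.

Definition proposal_law : probability (Y * R)%type R :=
  nu \x unif01.

Lemma measurable_gaccept n : measurable (gaccept n).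
Proof.
have m1 : measurable_fun [set: (Y * R)%type] (fun p : Y * R => gtau n + gsurv n * p.2)%R.
  by apply: measurable_funD => //; apply: measurable_funM.
have m2 : measurable_fun [set: (Y * R)%type] (fun p : Y * R => v p.1).
  exact: (measurableT_comp mv (@measurable_fst _ _ Y R)).
rewrite -[X in measurable X]setTI.
exact: (measurable_fun_ltr m1 m2 measurableT (Y := [set true])).
Qed.
Hint Resolve measurable_gaccept : core.

(** For fixed [y] the acceptance probability is [(v y - gtau n) / gsurv n] clipped to the unit
    interval; multiplied by [gsurv n] it becomes the band of [v] between two consecutive heights. If
    [gsurv n = 0], the band has zero mass. *)
Lemma proposal_law_accept n (B : set Y) : measurable B ->
  (gsurv n)%:E * proposal_law (gaccept n `&` (B `*` setT)) =
  \int[nu]_(y in B) (gband n y)%:E.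
Proof.
move=> mB; have [s0|s_neq0] := eqVneq (gsurv n) 0%R.
  rewrite s0 mul0e; apply/esym/eqP; rewrite eq_le; apply/andP; split; last first.
    by apply: integral_ge0 => y _; rewrite lee_fin.
  apply: (@le_trans _ _ (\int[nu]_y (gband n y)%:E)).
    apply: ge0_subset_integral => //; first exact/measurable_EFinP.
    by move=> y _; rewrite lee_fin.
  by rewrite integral_gband lee_fin s0 sub0r oppr_le0.
have s_gt0 : (0 < gsurv n)%R by rewrite lt0r s_neq0 gsurv_ge0.
rewrite /proposal_law /= /product_measure1 [RHS]integral_mkcond.
have mA : measurable (gaccept n `&` (B `*` setT)).
  by apply: measurableI => //; exact: measurableX.
rewrite -ge0_integralZl//; last 2 first.
  exact: (measurable_fun_xsection unif01 mA).
  by rewrite lee_fin.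
apply: eq_integral => y _; rewrite patchE /=; have [yB|yB] := boolP (y \in B); last first.
  rewrite (_ : xsection _ _ = set0) ?measure0 ?mule0//.
  apply/seteqP; split => // u; rewrite /xsection /= inE => -[_ [/= By _]].
  by move: yB; rewrite mem_set.
rewrite (_ : xsection _ _ = [set u | (u < (v y - gtau n) / gsurv n)%R]); last first.
  apply/seteqP; split => u; rewrite /xsection /= inE /gaccept /= ltr_pdivlMr// ltrBrDl mulrC.
    by case.
  by move=> h; do 2 split => //; move: yB; rewrite inE.
rewrite unif01_lt -EFinM; congr EFin; rewrite /gband gtauS.
set q := (_ / _)%R; have qE : (q * gsurv n = v y - gtau n)%R by rewrite /q divfK.
have [q0|q0] := leP q 0%R.
  rewrite (max_idPl _) ?ge_min ?q0// mulr0.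
  have vt : (v y <= gtau n)%R by rewrite -subr_le0 -qE mulr_le0_ge0.
  by rewrite (min_idPl vt) (min_idPl (le_trans vt (gtau_le n))) subrr.
have tv : (gtau n <= v y)%R by rewrite -subr_ge0 -qE mulr_ge0// ltW.
rewrite (min_idPr tv).
have [q1|q1] := leP q 1%R.
  have vle : (v y <= gtau n + gsurv n)%R.
    by rewrite -lerBlDl -qE -[leRHS]mul1r ler_pM2r.
  by rewrite (max_idPr (ltW q0)) mulrC qE (min_idPl vle).
have vge : (gtau n + gsurv n <= v y)%R.
  by rewrite -lerBrDl -qE -[leLHS]mul1r ler_pM2r// ltW.
by rewrite (max_idPr ler01) mulr1 (min_idPr vge) [(gtau n + _)%R]addrC addrK.
Qed.

Lemma proposal_law_reject n :
  (gsurv n)%:E * proposal_law (~` gaccept n) = (gsurv n.+1)%:E.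
Proof.
have := proposal_law_accept n measurableT.
rewrite setXTT setIT integral_gband => acc.
rewrite probability_setC// muleBr ?fin_num_measure// mule1.
by rewrite acc -EFinB; congr EFin; rewrite subKr.
Qed.

Lemma prod_proposal_law_reject n :
  \prod_(j < n) proposal_law (~` gaccept j) = (gsurv n)%:E.
Proof.
elim: n => [|n IHn]; first by rewrite big_ord0 gsurv0.
by rewrite big_ord_recr/= IHn proposal_law_reject.
Qed.

Definition gbox (n : nat) (B : set Y) : set (iid_space (W := (Y * R)%type)) :=
  [set w | (forall j, (j < n)%N -> ~ gaccept j (w j)) /\
           gaccept n (w n) /\ B (w n).1].

Lemma iid_law_gbox n B : measurable B ->
  iid_law proposal_law (gbox n B) = \int[nu]_(y in B) (gband n y)%:E.
Proof.
move=> mB.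
pose A j := if (j < n)%N then ~` gaccept j else gaccept n `&` (B `*` setT).
have mA j : measurable (A j).
  rewrite /A; case: ifP => _; first exact: measurableC.
  by apply: measurableI => //; exact: measurableX.
rewrite (_ : gbox n B = [set w | forall j, (j < n.+1)%N -> A j (w j)]).
  rewrite (iid_law_box proposal_law n.+1 mA) big_ord_recr/= {2}/A ltnn.
  rewrite -proposal_law_accept// -prod_proposal_law_reject; congr (_ * _).
  by apply: eq_bigr => j _; rewrite /A ltn_ord.
apply/seteqP; split => w /=.
  move=> [rej [acc Bw]] j; rewrite ltnS leq_eqVlt => /predU1P[->|jn].
    by rewrite /A ltnn.
  by rewrite /A jn; exact: rej.
move=> wA; split => [j jn|].
  by have := wA j (leqW jn); rewrite /A jn.
by have := wA n (leqnn _); rewrite /A ltnn => -[? []].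
Qed.

End greedy_rejection.

(** * The mean logarithm of the density against mutual information *)

Section information_bound.
Context {R : realType} {dX dY : measure_display} {X : measurableType dX}
  {Y : measurableType dY}.
Variables (mu0 : probability X R) (Q : R.-pker X ~> Y).
Local Notation nu := (marginal_law mu0 Q).
Variable f : X * Y -> R.
Hypothesis mf : measurable_fun setT f.
Hypothesis f0 : forall p, (0 <= f p)%R.
Hypothesis f1 : forall x, \int[nu]_y (f (x, y))%:E = 1.
Definition joint_density_for (mu : probability X R) := forall A, measurable A ->
  joint_law mu Q A = \int[mu]_x \int[nu]_y ((f (x, y))%:E * (\1_A (x, y))%:E).

Let mfE : measurable_fun setT (EFin \o f). Proof. exact/measurable_EFinP. Qed.
Let f0E p : 0 <= (f p)%:E. Proof. by rewrite lee_fin. Qed.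

Lemma ge0_integral_joint_law (mu : probability X R) (k : X * Y -> \bar R) :
  joint_density_for mu -> (forall p, 0 <= k p) -> measurable_fun setT k ->
  \int[joint_law mu Q]_p k p = \int[mu]_x \int[nu]_y (k (x, y) * (f (x, y))%:E).
Proof.
move=> dens k0 mk.
pose lam : probability (X * Y)%type R := mu \x nu.
rewrite (ge0_integral_density (lam := lam) (f := EFin \o f) f0E mfE _ k0 mk).
  apply: (fubini_tonelli1 (m1 := mu) (m2 := nu) (fun p => k p * (f p)%:E)).
    exact: emeasurable_funM.
  by move=> p; rewrite mule_ge0.
move=> A mA; rewrite [LHS](dens A mA) [RHS]integral_mkcond.
rewrite [RHS](eq_integral (fun p => (f p)%:E * (\1_A p)%:E)); last first.
  by move=> p _; rewrite epatch_indic.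
apply/esym.
apply: (fubini_tonelli1 (m1 := mu) (m2 := nu) (fun p => (f p)%:E * (\1_A p)%:E)).
  apply: emeasurable_funM => //.
  by apply/measurable_EFinP; exact: measurable_indic.
by move=> p; rewrite mule_ge0// lee_fin.
Qed.

Lemma ge0_integral_marginal_law (mu : probability X R) (h : Y -> \bar R) :
  joint_density_for mu -> (forall y, 0 <= h y) -> measurable_fun setT h ->
  \int[marginal_law mu Q]_y h y = \int[mu]_x \int[nu]_y (h y * (f (x, y))%:E).
Proof.
move=> dens h0 mh.
have mh2 : measurable_fun setT (h \o snd : X * Y -> \bar R).
  exact: (measurableT_comp mh (@measurable_snd _ _ X Y)).
rewrite -(ge0_integral_joint_law dens (k := h \o snd))//; last by move=> p; exact: h0.
rewrite (eq_measure_integral (pushforward (joint_law mu Q) snd)).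
  by rewrite ge0_integral_pushforward.
move=> B mB _; have e : setT `*` B = (@snd X Y) @^-1` B.
  by apply/seteqP; split => [[x y] []|[x y]].
by have := marginal_lawE mu Q B; rewrite e.
Qed.

(** Integrate the tangent of [expR] at the mean [b] against the law of density [f (x, .)]. The terms
    are arranged so that all integrands are nonnegative, and the bound [M] makes the integrals
    finite. *)
Lemma expR_jensen (B : Y -> R) (M : R) x : measurable_fun setT B ->
  (forall y, 0 <= B y <= M)%R ->
  (expR (fine (\int[nu]_y ((B y)%:E * (f (x, y))%:E))))%:E <=
  \int[nu]_y ((expR (B y))%:E * (f (x, y))%:E).
Proof.
move=> mB BM.
have mfx : measurable_fun setT (fun y => f (x, y)).
  exact: (measurableT_comp mf (measurable_pair1 x)).
have mEB : measurable_fun setT (fun y => expR (B y)).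
  exact: (measurableT_comp (@measurable_expR R) mB).
have B0 y : (0 <= B y)%R by have /andP[] := BM y.
have intC (k : R) : (0 <= k)%R -> \int[nu]_y (k%:E * (f (x, y))%:E) = k%:E.
  move=> k0; rewrite ge0_integralZl ?f1 ?mule1//; exact/measurable_EFinP.
have bounded (u : Y -> R) (k : R) : measurable_fun setT u ->
    (forall y, 0 <= u y <= k)%R ->
    \int[nu]_y ((u y)%:E * (f (x, y))%:E) \is a fin_num.
  move=> mu uk; have k0 : (0 <= k)%R by have /andP[] := uk point; exact: le_trans.
  have u0 y : (0 <= u y)%R by have /andP[] := uk y.
  rewrite ge0_fin_numE; last by apply: integral_ge0 => y _; rewrite mule_ge0// lee_fin.
  apply: (@le_lt_trans _ _ (\int[nu]_y (k%:E * (f (x, y))%:E))); last by rewrite intC// ltry.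
  apply: ge0_le_integral => //.
  - by move=> y _; rewrite mule_ge0// lee_fin.
  - by apply: emeasurable_funM; apply/measurable_EFinP.
  - by apply: emeasurable_funM; apply/measurable_EFinP.
  - by move=> y _; rewrite lee_wpmul2r// lee_fin; have /andP[] := uk y.
set b := fine _.
have bE : \int[nu]_y ((B y)%:E * (f (x, y))%:E) = b%:E.
  by rewrite fineK// (bounded B M).
have b0 : (0 <= b)%R.
  by rewrite -lee_fin -bE; apply: integral_ge0 => y _; rewrite mule_ge0// lee_fin.
have E1 : \int[nu]_y ((expR (B y))%:E * (f (x, y))%:E) \is a fin_num.
  apply: (bounded _ (expR M)) => // y.
  by rewrite expR_ge0/= ler_expR; have /andP[] := BM y.
have eb0 := expR_ge0 b.
pose t1 y := (expR b)%:E * (f (x, y))%:E.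
pose t2 y := (expR b)%:E * ((B y)%:E * (f (x, y))%:E).
pose t3 y := (expR (B y))%:E * (f (x, y))%:E.
pose t4 y := (expR b * b)%:E * (f (x, y))%:E.
have t1_ge0 y : setT y -> 0 <= t1 y by rewrite /t1 mule_ge0// lee_fin.
have t2_ge0 y : setT y -> 0 <= t2 y by rewrite /t2 !mule_ge0// lee_fin.
have t3_ge0 y : setT y -> 0 <= t3 y by rewrite /t3 mule_ge0// lee_fin expR_ge0.
have t4_ge0 y : setT y -> 0 <= t4 y by rewrite /t4 mule_ge0// lee_fin mulr_ge0.
have mfxE : measurable_fun setT (fun y => (f (x, y))%:E) by exact/measurable_EFinP.
have mBf : measurable_fun setT (fun y => (B y)%:E * (f (x, y))%:E).
  by apply: emeasurable_funM => //; exact/measurable_EFinP.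
have mt1 : measurable_fun setT t1 by exact: emeasurable_funM.
have mt2 : measurable_fun setT t2 by exact: emeasurable_funM.
have mt3 : measurable_fun setT t3 by apply: emeasurable_funM => //; exact/measurable_EFinP.
have mt4 : measurable_fun setT t4 by exact: emeasurable_funM.
have : \int[nu]_y (t1 y + t2 y) <= \int[nu]_y (t3 y + t4 y).
  apply: ge0_le_integral => //.
  - by move=> y _; rewrite adde_ge0 ?t1_ge0 ?t2_ge0.
  - exact: emeasurable_funD.
  - exact: emeasurable_funD.
  - move=> y _; rewrite /t1 /t2 /t3 /t4 -!EFinM -!EFinD lee_fin mulrA -!mulrDl ler_wpM2r//.
    have := expR_ge1Dx (B y - b); rewrite expRB => h.
    have : (expR b * (1 + (B y - b)) <= expR b * (expR (B y) / expR b))%R by rewrite ler_wpM2l.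
    by rewrite [X in (_ <= X)%R]mulrC divfK ?gt_eqF ?expR_gt0//; lra.
rewrite !ge0_integralD// /t1 /t3 /t4 !intC ?mulr_ge0//.
have -> : \int[nu]_y t2 y = (expR b * b)%:E.
  by rewrite /t2 ge0_integralZl ?bE// => y _; rewrite mule_ge0// lee_fin.
by rewrite leeD2rE.
Qed.

Lemma measurable_integral_section (k : X * Y -> \bar R) (P : probability Y R) :
  measurable_fun setT k -> (forall p, 0 <= k p) ->
  measurable_fun setT (fun x => \int[P]_y k (x, y)).
Proof. by move=> mk k0; exact: (measurable_fun_fubini_tonelli_F (m2 := P) k mk k0). Qed.

(** Data processing in variational form: a test function [B] on outputs is replaced by its
    conditional mean [beta] on inputs, and Jensen shows that the exponential moment under [mu0] does
    not exceed that of [B] under [nu]. *)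
Lemma marginal_law_donsker_varadhan (mu : probability X R) (B : Y -> R) (M C : R) :
  joint_density_for mu0 -> joint_density_for mu -> measurable_fun setT B ->
  (forall y, 0 <= B y <= M)%R -> (0 < C)%R ->
  \int[nu]_y (expR (B y))%:E <= C%:E ->
  \int[marginal_law mu Q]_y (B y)%:E <= KL mu mu0 * (ln 2)%:E + (ln C)%:E.
Proof.
move=> dens0 dens mB BM C0 expC.
have B0 y : (0 <= B y)%R by have /andP[] := BM y.
have mBE : measurable_fun setT (EFin \o B) by exact/measurable_EFinP.
pose k p := (B p.2)%:E * (f p)%:E.
have mk : measurable_fun setT k.
  apply: emeasurable_funM => //.
  exact: (measurableT_comp mBE (@measurable_snd _ _ X Y)).
have k0 p : 0 <= k p by rewrite mule_ge0// lee_fin.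
pose beta x := fine (\int[nu]_y k (x, y)).
have int_fin x : \int[nu]_y k (x, y) \is a fin_num.
  have M0 : (0 <= M)%R by have /andP[/le_trans h /h] := BM point.
  have mfx : measurable_fun setT (fun y => (f (x, y))%:E).
    exact: (measurableT_comp mfE (measurable_pair1 x)).
  rewrite ge0_fin_numE; last by apply: integral_ge0 => y _.
  apply: (@le_lt_trans _ _ (\int[nu]_y (M%:E * (f (x, y))%:E))).
    apply: ge0_le_integral => //.
    - exact: (measurableT_comp mk (measurable_pair1 x)).
    - exact: emeasurable_funM.
    - by move=> y _; rewrite lee_wpmul2r// lee_fin; have /andP[] := BM y.
  by rewrite ge0_integralZl ?f1 ?mule1 ?ltry.
have betaE x : (beta x)%:E = \int[nu]_y k (x, y) by rewrite fineK.
have mbeta : measurable_fun setT beta.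
  apply/measurable_EFinP; rewrite (_ : _ \o _ = fun x => \int[nu]_y k (x, y)).
    exact: measurable_integral_section.
  by apply/funext => x /=; rewrite betaE.
have beta0 x : (0 <= beta x)%R by rewrite fine_ge0// integral_ge0.
have -> : \int[marginal_law mu Q]_y (B y)%:E = \int[mu]_x (beta x)%:E.
  rewrite (ge0_integral_marginal_law dens)//.
  by apply: eq_integral => x _; rewrite betaE.
apply: donsker_varadhan => //; apply: le_trans expC.
have mEB : measurable_fun setT (EFin \o (expR \o B)).
  by apply/measurable_EFinP; exact: (measurableT_comp (@measurable_expR R) mB).
have -> : \int[nu]_y (expR (B y))%:E =
    \int[mu0]_x \int[nu]_y ((expR (B y))%:E * (f (x, y))%:E).
  apply: (ge0_integral_marginal_law dens0 (h := EFin \o (expR \o B))) => // y.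
  by rewrite lee_fin /= expR_ge0.
apply: ge0_le_integral => //.
- by apply/measurable_EFinP; exact: (measurableT_comp (@measurable_expR R) mbeta).
- apply: (measurable_integral_section (k := fun p => (expR (B p.2))%:E * (f p)%:E)).
    apply: emeasurable_funM => //.
    exact: (measurableT_comp mEB (@measurable_snd _ _ X Y)).
  by move=> p; rewrite mule_ge0// lee_fin expR_ge0.
- by move=> x _; exact: (expR_jensen x mB BM).
Qed.

(** The chain rule in variational form. With [r] the density of the output law of [mu], split
    [ln (1 + c f)] into [ln ((1 + c f) / (1 + c r))], tested on the joint law against the product of
    its marginals, and [ln (1 + c r)], tested on the output law. *)
Lemma truncated_information_bound (mu : probability X R) (c N : R) :
  joint_density_for mu0 -> joint_density_for mu -> (0 < c)%R -> (0 <= N)%R ->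
  \int[joint_law mu Q]_p (Num.min (ln (1 + c * f p)) N)%:E <=
  MI mu Q * (ln 2)%:E + KL mu mu0 * (ln 2)%:E + (ln (1 + c) + 1 / 20)%:E.
Proof.
move=> dens0 dens c0 N0.
(* The density of the output law of [mu] with respect to [nu]. It may be infinite on a null set,
   hence the finite version [r] below. *)
pose m y := \int[mu]_x (f (x, y))%:E.
have m0 y : 0 <= m y by apply: integral_ge0.
have mm : measurable_fun setT m.
  exact: (measurable_fun_fubini_tonelli_G (m1 := mu) (EFin \o f) mfE f0E).
have int_mE h : (forall y, 0 <= h y) -> measurable_fun setT h ->
    \int[marginal_law mu Q]_y h y = \int[nu]_y (h y * m y).
  move=> h0 mh; rewrite (ge0_integral_marginal_law dens)//.
  rewrite (fubini_tonelli (m1 := mu) (m2 := nu) (fun p => h p.2 * (f p)%:E)).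
  - apply: eq_integral => y _; rewrite /= ge0_integralZl//.
    exact: (measurableT_comp mfE (measurable_pair2 y)).
  - apply: emeasurable_funM => //.
    exact: (measurableT_comp mh (@measurable_snd _ _ X Y)).
  - by move=> p; rewrite mule_ge0.
have int_m : \int[nu]_y m y = 1.
  have := int_mE (cst 1) (fun=> lee01) (measurable_cst 1).
  rewrite [LHS](integral_cst (marginal_law mu Q) measurableT 1) mul1e.
  rewrite [LHS](probability_setT (marginal_law mu Q)) => ->.
  by apply: eq_integral => y _; rewrite mul1e.
pose r y := fine (m y).
have r0 y : (0 <= r y)%R by rewrite fine_ge0.
have mr : measurable_fun setT r by exact: measurableT_comp.
have m_ae : ae_eq nu setT m (EFin \o r).
  have mint : nu.-integrable setT m.
    by apply/integrableP; split => //; under eq_integral do rewrite gee0_abs//; rewrite int_m ltry.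
  by apply: filterS (integrable_ae measurableT mint) => y my _ /=; rewrite fineK// my.
have int_r : \int[nu]_y (r y)%:E = 1.
  rewrite -int_m; apply: ae_eq_integral => //; first exact/measurable_EFinP.
  exact: ae_eq_sym.
(* [B] is truncated well above [A], so that truncating costs only [expR (- 20)] *)
pose M := (N + 20)%R.
have M0 : (0 <= M)%R by rewrite addr_ge0.
pose B y := Num.min (ln (1 + c * r y)) M.
have cr0 y : (0 <= c * r y)%R by rewrite mulr_ge0// ltW.
have cf0 p : (0 <= c * f p)%R by rewrite mulr_ge0// ltW.
have BM y : (0 <= B y <= M)%R.
  by rewrite le_min ge_min lexx orbT andbT M0 andbT ln_ge0// lerDl.
have mB : measurable_fun setT B.
  apply: measurable_minr => //; apply: (measurableT_comp (@measurable_ln R)).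
  by apply: measurable_funD => //; exact: measurable_funM.
have expB : \int[nu]_y (expR (B y))%:E <= (1 + c)%:E.
  apply: (@le_trans _ _ (\int[nu]_y (1 + c%:E * (r y)%:E))).
    apply: ge0_le_integral => //.
    - by apply/measurable_EFinP; exact: (measurableT_comp (@measurable_expR R) mB).
    - apply: emeasurable_funD => //; apply: emeasurable_funM => //; exact/measurable_EFinP.
    - move=> y _; rewrite -EFinM -EFinD lee_fin -[leRHS]lnK ?posrE; last first.
        by have := cr0 y; lra.
      by rewrite ler_expR ge_min lexx.
  rewrite ge0_integralD//; last 2 first.
    by move=> y _; rewrite mule_ge0// lee_fin// ltW.
    by apply: emeasurable_funM => //; exact/measurable_EFinP.
  rewrite [X in X + _](integral_cst nu measurableT 1) mul1e [X in X + _](probability_setT nu).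
  have -> : \int[nu]_y (c%:E * (r y)%:E) = c%:E.
    rewrite ge0_integralZl ?int_r ?mule1 ?lee_fin ?(ltW c0)//.
    exact/measurable_EFinP.
    by move=> y _; rewrite lee_fin.
  by rewrite EFinD lexx.
have c1 : (0 < 1 + c)%R by lra.
have dv2 := marginal_law_donsker_varadhan dens0 dens mB BM c1 expB.
pose A p := Num.min (ln (1 + c * f p)) N.
have A0 p : (0 <= A p)%R by rewrite le_min N0 andbT ln_ge0// lerDl.
have mA : measurable_fun setT A.
  apply: measurable_minr => //; apply: (measurableT_comp (@measurable_ln R)).
  by apply: measurable_funD => //; exact: measurable_funM.
have B0 y : (0 <= B y)%R by have /andP[] := BM y.
have BleM y : (B y <= M)%R by have /andP[] := BM y.
have mB2 : measurable_fun setT (fun p : X * Y => B p.2).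
  exact: (measurableT_comp mB (@measurable_snd _ _ X Y)).
(* The shift by [M] makes the test function nonnegative; it reappears as the factor [expR M] in the
   exponential moment and cancels at the end. *)
pose phi p := (A p + (M - B p.2))%R.
have phi0 p : (0 <= phi p)%R by rewrite addr_ge0// subr_ge0.
have mphi : measurable_fun setT phi.
  by apply: measurable_funD => //; exact: measurable_funB.
pose num p := (1 + c * f p)%R; pose den y := (1 + c * r y)%R.
have num_gt0 p : (0 < num p)%R by have := cf0 p; rewrite /num; lra.
have den_gt0 y : (0 < den y)%R by have := cr0 y; rewrite /den; lra.
have mnum : measurable_fun setT (EFin \o num).
  by apply/measurable_EFinP; apply: measurable_funD => //; exact: measurable_funM.
have mdenV : measurable_fun setT (fun y => ((den y)^-1)%:E).
  apply/measurable_EFinP; rewrite (_ : (fun y => _) = (fun y => expR (- ln (den y)))).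
    apply: (measurableT_comp (@measurable_expR R)); apply: measurableT_comp => //.
    apply: (measurableT_comp (@measurable_ln R)).
    by apply: measurable_funD => //; exact: measurable_funM.
  by apply/funext => y; rewrite expRN lnK// posrE.
pose P2 : probability (X * Y)%type R := mu \x marginal_law mu Q.
(* the mean of [num / den] under the product of the marginals is 1, since the mean
   of [num] over [mu] is [den] almost surely *)
have ratio1 : \int[P2]_p ((num p)%:E * ((den p.2)^-1)%:E) = 1.
  have mrat : measurable_fun setT (fun p : X * Y => (num p)%:E * ((den p.2)^-1)%:E).
    apply: emeasurable_funM => //.
    exact: (measurableT_comp mdenV (@measurable_snd _ _ X Y)).
  have rat0 (p : X * Y) : 0 <= (num p)%:E * ((den p.2)^-1)%:E.
    by rewrite mule_ge0// lee_fin ?invr_ge0 ltW.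
  transitivity (\int[mu]_x \int[marginal_law mu Q]_y ((num (x, y))%:E * ((den y)^-1)%:E)).
    exact: (fubini_tonelli1 (m1 := mu) (m2 := marginal_law mu Q) _ mrat rat0).
  rewrite (fubini_tonelli (m1 := mu) (m2 := marginal_law mu Q)
    (fun p => (num p)%:E * ((den p.2)^-1)%:E))//=.
  have int_num y : \int[mu]_x (num (x, y))%:E = 1 + c%:E * m y.
    under eq_integral do rewrite /num EFinD EFinM.
    rewrite ge0_integralD//.
    - rewrite [X in X + _](integral_cst mu measurableT 1) mul1e [X in X + _](probability_setT mu).
      rewrite ge0_integralZl ?lee_fin ?(ltW c0)//.
      exact: (measurableT_comp mfE (measurable_pair2 y)).
    - by move=> x _; rewrite mule_ge0// lee_fin ltW.
    - apply: emeasurable_funM => //.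
      exact: (measurableT_comp mfE (measurable_pair2 y)).
  under eq_integral => y _.
    rewrite ge0_integralZr; [|exact: measurableT| | |].
    rewrite int_num; over.
    exact: (measurableT_comp mnum (measurable_pair2 y)).
    by move=> x _; rewrite lee_fin ltW.
    by rewrite lee_fin invr_ge0 ltW.
  have mcm : measurable_fun setT (fun y => (1 + c%:E * m y) * ((den y)^-1)%:E).
    by apply: emeasurable_funM => //; apply: emeasurable_funD => //; exact: emeasurable_funM.
  rewrite int_mE//; last first.
    by move=> y; rewrite mule_ge0 ?lee_fin ?invr_ge0 ?(ltW (den_gt0 y))// adde_ge0// mule_ge0// lee_fin ltW.
  rewrite -[RHS]int_r; apply: ae_eq_integral => //.
  - exact: emeasurable_funM.
  - exact/measurable_EFinP.
  - apply: filterS m_ae => y my yT; rewrite my//=.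
    rewrite (_ : 1 + c%:E * (r y)%:E = (den y)%:E); last by rewrite /den EFinD EFinM.
    by rewrite -!EFinM divff ?gt_eqF// mul1r.
have exp_phi : \int[P2]_p (expR (phi p))%:E <= (expR M * (1 + expR (- 20)))%:E.
  have mrat : measurable_fun setT (fun p : X * Y => (num p)%:E * ((den p.2)^-1)%:E).
    apply: emeasurable_funM => //.
    exact: (measurableT_comp mdenV (@measurable_snd _ _ X Y)).
  have rat0 (p : X * Y) : setT p -> 0 <= (num p)%:E * ((den p.2)^-1)%:E.
    by rewrite mule_ge0// lee_fin ?invr_ge0 ltW.
  apply: (@le_trans _ _ (\int[P2]_p ((expR M)%:E *
      ((num p)%:E * ((den p.2)^-1)%:E + (expR (- 20))%:E)))).
    apply: ge0_le_integral => //.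
    - by apply/measurable_EFinP; exact: (measurableT_comp (@measurable_expR R) mphi).
    - by apply: emeasurable_funM => //; exact: emeasurable_funD.
    - move=> p _; rewrite -[(num p)%:E * _]EFinM -EFinD -EFinM lee_fin /phi addrCA expRD ler_pM2l ?expR_gt0//.
      (* Either [B] is not truncated and the ratio appears, or [B = M] and [A - M <= - 20]. *)
      have [lM|lM] := leP (ln (den p.2)) M.
        rewrite /B -/(den p.2) (min_idPl lM).
        apply: (@le_trans _ _ (expR (ln (num p) - ln (den p.2)))).
          by rewrite ler_expR lerD2r ge_min lexx.
        by rewrite expRB !lnK ?posrE// lerDl expR_ge0.
      rewrite /B -/(den p.2) (min_idPr (ltW lM)).
      apply: (@le_trans _ _ (expR (- 20))).
        rewrite ler_expR; have : (A p <= N)%R by rewrite ge_min lexx orbT.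
        by rewrite /M; lra.
      by rewrite lerDr mulr_ge0 ?invr_ge0 ?ltW.
  pose s p := (num p)%:E * ((den p.2)^-1)%:E + (expR (- 20))%:E.
  have ms : measurable_fun setT s by exact: emeasurable_funD.
  have s0 p : setT p -> 0 <= s p by move=> pT; rewrite adde_ge0 ?rat0// lee_fin expR_ge0.
  have eM0 : 0 <= (expR M)%:E by rewrite lee_fin expR_ge0.
  rewrite (ge0_integralZl P2 measurableT ms s0 eM0) /s.
  have e0 (p : X * Y) : setT p -> 0 <= (expR (- 20) : R)%:E by rewrite lee_fin expR_ge0.
  rewrite (@ge0_integralD _ _ _ P2 setT measurableT _ (fun=> (expR (- 20))%:E) rat0 mrat e0)//.
  rewrite ratio1 (integral_cst P2 measurableT (expR (- 20))%:E).
  by rewrite [X in _ + _ * X](probability_setT P2) mule1 EFinM EFinD lexx.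
have K0 : (0 < expR M * (1 + expR (- 20)) :> R)%R by rewrite mulr_gt0 ?expR_gt0// addr_gt0// expR_gt0.
have dv1 := donsker_varadhan (joint_law mu Q) (P0 := P2) K0 mphi phi0 exp_phi.
have small : (ln (1 + expR (- 20)) <= 1 / 20 :> R)%R.
  have e0 := expR_gt0 (- 20 : R).
  apply: (@le_trans _ _ (expR (- 20))).
    by have := @ln_le_subr1 R (1 + expR (- 20)) ltac:(lra); lra.
  rewrite expRN div1r lef_pV2 ?posrE ?expR_gt0//.
  by have := expR_ge1Dx (20 : R); lra.
have intB : \int[joint_law mu Q]_p (B p.2)%:E = \int[marginal_law mu Q]_y (B y)%:E.
  rewrite (ge0_integral_marginal_law dens)//; last exact/measurable_EFinP.
  apply: (ge0_integral_joint_law dens (k := fun p => (B p.2)%:E)).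
    by move=> p; rewrite lee_fin.
  exact/measurable_EFinP.
have sum_eq : \int[joint_law mu Q]_p (A p)%:E + M%:E =
    \int[joint_law mu Q]_p (phi p)%:E + \int[joint_law mu Q]_p (B p.2)%:E.
  have -> : M%:E = \int[joint_law mu Q]_p (cst M p)%:E.
    rewrite [RHS](integral_cst (joint_law mu Q) measurableT M%:E).
    by rewrite [X in _ * X](probability_setT (joint_law mu Q)) mule1.
  rewrite -!ge0_integralD//; do ?[exact/measurable_EFinP|by move=> p _; rewrite lee_fin].
  by apply: eq_integral => p _; rewrite -!EFinD /phi -addrA subrK.
rewrite -(leeD2rE (x := M%:E))// sum_eq intB.
apply: (le_trans (leeD dv1 dv2)); rewrite addeACA -[leRHS]addeA leeD//.
have K1 : (0 < 1 + expR (- 20) :> R)%R by rewrite addr_gt0// expR_gt0.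
rewrite lnM ?posrE ?expR_gt0//.
by rewrite expRK -!EFinD lee_fin; lra.
Qed.

Lemma information_bound (mu : probability X R) (c : R) :
  joint_density_for mu0 -> joint_density_for mu -> (0 < c)%R ->
  \int[mu]_x \int[nu]_y (f (x, y) * ln (1 + c * f (x, y)))%:E <=
  MI mu Q * (ln 2)%:E + KL mu mu0 * (ln 2)%:E + (ln (1 + c) + 1 / 20)%:E.
Proof.
move=> dens0 dens c0; pose L p := ln (1 + c * f p).
have L0 p : (0 <= L p)%R by rewrite ln_ge0// lerDl mulr_ge0// ltW.
have mL : measurable_fun setT L.
  apply: (measurableT_comp (@measurable_ln R)).
  by apply: measurable_funD => //; exact: measurable_funM.
have -> : \int[mu]_x \int[nu]_y (f (x, y) * ln (1 + c * f (x, y)))%:E =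
    \int[joint_law mu Q]_p (L p)%:E.
  rewrite (ge0_integral_joint_law dens (k := EFin \o L)).
  - by apply: eq_integral => x _; apply: eq_integral => y _; rewrite EFinM muleC.
  - by move=> p; rewrite lee_fin.
  - exact/measurable_EFinP.
pose g n p := (Num.min (L p) n%:R)%:E.
have mg n : measurable_fun setT (g n) by apply/measurable_EFinP; exact: measurable_minr.
have g0 n p : setT p -> 0 <= g n p by rewrite lee_fin le_min L0 ler0n.
have g_homo p : setT p -> {homo g ^~ p : m n / (m <= n)%N >-> m <= n}.
  move=> _ m n mn; rewrite lee_fin le_min !ge_min lexx/= ler_nat mn.
  by rewrite orbT.
have -> : \int[joint_law mu Q]_p (L p)%:E = \int[joint_law mu Q]_p limn (g ^~ p).
  apply: eq_integral => p _; apply/esym/lim_near_cst => //.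
  near=> n; rewrite /g (min_idPl _)//.
  near: n; exact: nbhs_infty_ger.
rewrite monotone_convergence//; apply: lime_le.
  apply: ereal_nondecreasing_is_cvgn => m n mn; apply: ge0_le_integral => //.
  - by move=> p pT; exact: g0.
  - by move=> p pT; exact: g_homo.
by apply: nearW => n; exact: truncated_information_bound.
Unshelve. all: end_near. Qed.

End information_bound.

(** * Law and mean log-index of the accepted candidate *)

Section greedy_output.
Context {R : realType} {d : measure_display} {Y : measurableType d}.
Variables (nu : probability Y R) (v : Y -> R).
Hypothesis mv : measurable_fun setT v.
Hypothesis v0 : forall y, (0 <= v y)%R.
Hypothesis v1 : \int[nu]_y (v y)%:E = 1.

Local Notation gsurv := (gsurv nu v).
Local Notation gband := (gband nu v).
Local Notation gbox := (gbox nu v).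

Lemma gband_total : \sum_(i <oo) \int[nu]_y (gband i y)%:E = 1.
Proof.
have part n : \sum_(0 <= i < n) \int[nu]_y (gband i y)%:E = (1 - gsurv n)%:E.
  rewrite big_mkord; elim: n => [|n IHn]; first by rewrite big_ord0 gsurv0// subrr.
  by rewrite big_ord_recr/= IHn integral_gband// -EFinD; congr EFin; lra.
under eq_fun do rewrite part.
have s_ge0 := gsurv_ge0 mv v0 v1; have s_le := gsurv_le mv v0 v1.
apply/cvg_lim => //; apply: cvg_EFin; first exact: nearW.
rewrite (_ : fine \o _ = fun n => 1 - gsurv n)%R; last exact/funext.
rewrite -[X in _ --> X]subr0; apply: cvgB; first exact: cvg_cst.
apply/cvgrPdist_lt => e e0; have [n0 sn0] := gsurv_lt mv v0 v1 e0.
have s_homo n : (n0 <= n)%N -> (gsurv n <= gsurv n0)%R.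
  elim: n => [|n IHn]; first by rewrite leqn0 => /eqP ->.
  rewrite leq_eqVlt => /predU1P[->//|]; rewrite ltnS => /IHn.
  exact: le_trans.
near=> n; rewrite sub0r normrN ger0_norm//; apply: le_lt_trans sn0.
by apply: s_homo; near: n; exists n0.
Unshelve. all: end_near. Qed.

Lemma gbox_inj i j w : gbox i setT w -> gbox j setT w -> i = j.
Proof.
move=> [ri [ai _]] [rj [aj _]]; case: (ltngtP i j) => // ij.
  by case: (rj _ ij).
by case: (ri _ ij).
Qed.

Lemma gbox_trivIset B : trivIset setT (fun i => gbox i B).
Proof.
by move=> i j _ _ [w [[ri [ai _]] [rj [aj _]]]]; apply: (@gbox_inj _ _ w).
Qed.

Lemma measurable_gbox i B : measurable B -> measurable (gbox i B).
Proof.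
move=> mB; have mcoord j := measurable_iid_coord j (W := (Y * R)%type).
have macc j : measurable ((fun w : iid_space (W := (Y * R)%type) => w j) @^-1` gaccept nu v j).
  by rewrite -[X in measurable X]setTI; apply: mcoord => //; exact: measurable_gaccept.
have mBi : measurable ((fun w : iid_space (W := (Y * R)%type) => w i) @^-1` (B `*` setT)).
  by rewrite -[X in measurable X]setTI; apply: mcoord => //; exact: measurableX.
have -> : gbox i B =
    \bigcap_(j in [set j | (j < i)%N]) (~` ((fun w : iid_space (W := (Y * R)%type) => w j) @^-1` gaccept nu v j))
    `&` (((fun w : iid_space (W := (Y * R)%type) => w i) @^-1` gaccept nu v i)
    `&` ((fun w : iid_space (W := (Y * R)%type) => w i) @^-1` (B `*` setT))).
  by apply/seteqP; split => w /= [h1 [h2 h3]]; [|case: h3]; do ?split.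
apply: measurableI; last exact: measurableI.
by apply: bigcap_measurableType => j _; exact: measurableC.
Qed.

Lemma sum_eq1_squeeze (a b a' b' : \bar R) : 0 <= a -> 0 <= b -> a <= a' -> b <= b' ->
  a + b = 1 -> a' + b' = 1 -> a = a'.
Proof.
move=> a0 b0 aa' bb' ab ab'; apply/eqP; rewrite eq_le aa'/=.
have fb : b \is a fin_num.
  by rewrite ge0_fin_numE// (@le_lt_trans _ _ 1) ?ltry// -ab leeDr.
by rewrite -(leeD2rE (x := b))// ab -ab' leeD2l.
Qed.

(** Inequalities on [B] and on its complement between set functions of the same total must be
    equalities. Applied both to the target density and to the law of the output, this spares a
    separate treatment of the event of no acceptance. *)
Lemma gbox_law (G : set Y -> \bar R) : (forall B, measurable B -> 0 <= G B) ->
  (forall B, measurable B -> G B + G (~` B) = 1) ->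
  (forall B, measurable B ->
     \sum_(i <oo) \int[nu]_(y in B) (gband i y)%:E <= G B) ->
  forall B, measurable B ->  \sum_(i <oo) \int[nu]_(y in B) (gband i y)%:E = G B.
Proof.
move=> G0 GC Gle B mB; have mCB := measurableC mB.
have band0 C i : 0 <= \int[nu]_(y in C) (gband i y)%:E.
  by apply: integral_ge0 => y _; rewrite lee_fin gband_ge0.
apply: (sum_eq1_squeeze _ _ (Gle B mB) (Gle _ mCB) _ (GC B mB)).
- exact: nneseries_ge0.
- exact: nneseries_ge0.
rewrite -nneseriesD// -[RHS]gband_total; apply: eq_eseriesr => i _.
rewrite -ge0_integral_setU//.
- by rewrite setUv.
- by apply/measurable_EFinP/measurable_funTS; exact: measurable_gband.
- by move=> y _; rewrite lee_fin gband_ge0.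
- exact/disj_setPCl.
Qed.

Lemma gbox_law_density B : measurable B ->
  \sum_(i <oo) \int[nu]_(y in B) (gband i y)%:E = \int[nu]_(y in B) (v y)%:E.
Proof.
apply: (@gbox_law (fun B => \int[nu]_(y in B) (v y)%:E)).
- by move=> C mC; apply: integral_ge0 => y _; rewrite lee_fin.
- move=> C mC; rewrite -ge0_integral_setU//.
  + by rewrite setUv.
  + exact: measurableC.
  + exact/measurable_EFinP/measurable_funTS.
  + by move=> y _; rewrite lee_fin.
  + exact/disj_setPCl.
- move=> C mC; apply: lime_le.
    apply: is_cvg_nneseries => i _ _; apply: integral_ge0 => y _.
    by rewrite lee_fin gband_ge0.
  by apply: nearW => n; rewrite big_mkord integral_gband_sum_le.
Qed.

Lemma output_law (g : iid_space (W := (Y * R)%type) -> Y) :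
  measurable_fun setT g -> (forall i w, gbox i setT w -> g w = (w i).1) ->
  forall B, measurable B ->
    iid_law (proposal_law nu) (g @^-1` B) = \int[nu]_(y in B) (v y)%:E.
Proof.
move=> mg gE B mB; rewrite -gbox_law_density//; apply/esym.
apply: (@gbox_law (fun B => iid_law (proposal_law nu) (g @^-1` B))) => //.
  move=> C mC; rewrite preimage_setC -measureU//.
  - by rewrite setUv; exact: iid_law_setT.
  - by rewrite -[X in measurable X]setTI; exact: mg.
  - by apply: measurableC; rewrite -[X in measurable X]setTI; exact: mg.
  - by rewrite setICr.
move=> C mC; rewrite (eq_eseriesr (fun i _ => esym (iid_law_gbox mv v0 v1 i mC))).
rewrite (_ : \sum_(i <oo) _ = iid_law (proposal_law nu) (\bigcup_i gbox i C)).
  apply: le_measure; rewrite ?inE.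
  - by apply: bigcupT_measurable => i; exact: measurable_gbox.
  - by rewrite -[X in measurable X]setTI; exact: mg.
  - by move=> w [i _ [rej [acc Cw]]]; rewrite /preimage /= (gE i)//; split.
rewrite measure_bigcup//.
- by apply: eq_eseriesl => i; rewrite in_setT.
- by move=> i _; exact: measurable_gbox.
- exact: gbox_trivIset.
Qed.

Lemma iid_law_gboxT i :
  iid_law (proposal_law nu) (gbox i setT) = (gsurv i - gsurv i.+1)%:E.
Proof. by rewrite iid_law_gbox// integral_gband. Qed.

(** The value [p 0] only has to be finite because its weight is [ln 1 = 0]: the stopping index also
    takes the value 0 when nothing is accepted. *)
Lemma log_index_bound (p : nat -> \bar R) (c : R) : (1 <= c)%R ->
  (forall i, p i.+1 = iid_law (proposal_law nu) (gbox i.+1 setT)) ->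
  0 <= p 0%N < +oo ->
  \sum_(i <oo) p i * (ln i.+1%:R)%:E + (ln c)%:E <=
  \int[nu]_y (v y * ln (1 + c * v y))%:E + (2 * ln 2 - 1 / 2)%:E.
Proof.
move=> c1 pE /andP[p0 p0oo].
have term i : p i * (ln i.+1%:R)%:E = ((gsurv i - gsurv i.+1) * ln i.+1%:R)%:E.
  case: i => [|i]; first by rewrite ln1 mule0 mulr0.
  by rewrite pE iid_law_gboxT -EFinM.
rewrite (eq_eseriesr (fun i _ => term i)) -leeBrDr//; apply: lime_le.
  apply: is_cvg_nneseries => i _ _; rewrite lee_fin mulr_ge0// ?ln_ge0 ?ler1n//.
  by rewrite subr_ge0 gsurv_le.
apply: nearW => N; rewrite leeBrDr// sumEFin big_mkord -EFinD.
exact: gsurv_log_bound.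
Qed.

End greedy_output.

(** * The sampler as a jointly measurable function *)

Section joint_output.
Context {R : realType} {dX dY : measure_display} {X : measurableType dX}
  {Y : measurableType dY}.
Variables (nu : probability Y R) (f : X * Y -> R).
Hypothesis mf : measurable_fun setT f.
Hypothesis f0 : forall p, (0 <= f p)%R.
Hypothesis f1 : forall x, \int[nu]_y (f (x, y))%:E = 1.

Local Notation W := (Y * R)%type.
Local Notation Z := (iid_space (W := W)).
Local Notation fx x := (fun y => f (x, y)).

Let mfx x : measurable_fun setT (fx x).
Proof. exact: (measurableT_comp mf (measurable_pair1 x)). Qed.

Let fx0 x y : (0 <= f (x, y))%R. Proof. exact: f0. Qed.

(** The truncation height may itself vary with [x], as required by the recursion defining [gtau]. *)
Lemma measurable_trunc_mass_section (t : X -> R) : measurable_fun setT t ->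
  (forall x, 0 <= t x)%R -> measurable_fun setT (fun x => trunc_mass nu (fx x) (t x)).
Proof.
move=> mt t0; apply: measurableT_comp => //.
apply: (measurable_integral_section (k := fun p => (Num.min (f p) (t p.1))%:E)).
  apply/measurable_EFinP; apply: measurable_minr => //.
  exact: (measurableT_comp mt (@measurable_fst _ _ X Y)).
by move=> p; rewrite lee_fin le_min f0 t0.
Qed.

Lemma measurable_gtau_section n : measurable_fun setT (fun x => gtau nu (fx x) n).
Proof.
elim: n => [|n IHn] //=; apply: measurable_funD => //; apply: measurable_funB => //.
by apply: measurable_trunc_mass_section => // x; exact: gtau_ge0.
Qed.

Lemma measurable_gsurv_section n : measurable_fun setT (fun x => gsurv nu (fx x) n).
Proof.
apply: measurable_funB => //; apply: measurable_trunc_mass_section => [|x].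
  exact: measurable_gtau_section.
exact: gtau_ge0.
Qed.

Definition gbox_at (i : nat) : set (X * Z) :=
  [set p | gbox nu (fx p.1) i setT p.2].

Lemma measurable_coord_snd i : measurable_fun [set: X * Z] (fun p : X * Z => p.2 i).
Proof.
exact: (measurableT_comp (measurable_iid_coord i (W := W)) (@measurable_snd _ _ X Z)).
Qed.

Lemma measurable_gaccept_at i :
  measurable [set p : X * Z | gaccept nu (fx p.1) i (p.2 i)].
Proof.
have mfst := @measurable_fst _ _ X Z.
have mc1 : measurable_fun [set: X * Z] (fun p : X * Z => (p.2 i).1).
  exact: (measurableT_comp (@measurable_fst _ _ Y R) (measurable_coord_snd i)).
have mc2 : measurable_fun [set: X * Z] (fun p : X * Z => (p.2 i).2).
  exact: (measurableT_comp (@measurable_snd _ _ Y R) (measurable_coord_snd i)).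
have m1 : measurable_fun [set: X * Z]
    (fun p : X * Z => gtau nu (fx p.1) i + gsurv nu (fx p.1) i * (p.2 i).2)%R.
  apply: measurable_funD.
    exact: (measurableT_comp (measurable_gtau_section i) mfst).
  apply: measurable_funM => //.
  exact: (measurableT_comp (measurable_gsurv_section i) mfst).
have m2 : measurable_fun [set: X * Z] (fun p : X * Z => f (p.1, (p.2 i).1)).
  apply: (measurableT_comp mf); exact: measurable_fun_pair.
rewrite -[X in measurable X]setTI.
exact: (measurable_fun_ltr m1 m2 measurableT (Y := [set true])).
Qed.

Lemma measurable_gbox_at i : measurable (gbox_at i).
Proof.
have -> : gbox_at i =
    \bigcap_(j in [set j | (j < i)%N]) (~` [set p : X * Z | gaccept nu (fx p.1) j (p.2 j)])
    `&` [set p : X * Z | gaccept nu (fx p.1) i (p.2 i)].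
  by apply/seteqP; split => p /=; rewrite /gbox_at /gbox /=; [move=> [h1 [h2 _]]|move=> [h1 h2]].
apply: measurableI; last exact: measurable_gaccept_at.
by apply: bigcap_measurableType => j _; apply: measurableC; exact: measurable_gaccept_at.
Qed.

(** The default 0 makes the index total; it adds nothing to the mean of [ln (K + 1)]. *)
Definition stop_index (p : X * Z) : nat :=
  if pselect (exists i, gbox_at i p) is left e then projT1 (cid e) else 0%N.

Lemma stop_indexE i p : gbox_at i p -> stop_index p = i.
Proof.
move=> pi; rewrite /stop_index; case: pselect => [e|[]]; last by exists i.
by case: cid => j pj /=; apply: (gbox_inj (nu := nu) (v := fx p.1) (w := p.2)).
Qed.

Lemma stop_indexS i : stop_index @^-1` [set i.+1] = gbox_at i.+1.
Proof.
apply/seteqP; split => p /=; last exact: stop_indexE.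
by rewrite /stop_index; case: pselect => // e; case: cid => j pj /= <-.
Qed.

Lemma measurable_stop_index i : measurable (stop_index @^-1` [set i]).
Proof.
case: i => [|i]; last by rewrite stop_indexS; exact: measurable_gbox_at.
(* The fiber of 0 gathers acceptance at rank 0 and the default case, so it is described as the
   complement of the other fibers. *)
rewrite (_ : _ @^-1` _ = ~` \bigcup_i (gbox_at i.+1)).
  by apply: measurableC; apply: bigcupT_measurable => i; exact: measurable_gbox_at.
apply/seteqP; split => p /=.
  by move=> p0 [i _ /stop_indexE]; rewrite p0.
move=> h; case e : (stop_index p) => [//|i]; exfalso; apply: h; exists i => //.
by rewrite -stop_indexS.
Qed.

Definition output (p : X * Z) : Y := (p.2 (stop_index p)).1.

Lemma measurable_output : measurable_fun [set: X * Z] output.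
Proof.
move=> _ B mB; rewrite setTI.
rewrite (_ : _ @^-1` _ = \bigcup_i (stop_index @^-1` [set i] `&`
    (fun p : X * Z => (p.2 i).1) @^-1` B)).
  apply: bigcupT_measurable => i; apply: measurableI; first exact: measurable_stop_index.
  rewrite -[X in measurable X]setTI.
  exact: (measurableT_comp (@measurable_fst _ _ Y R) (measurable_coord_snd i)).
apply/seteqP; split => p /=; first by exists (stop_index p).
by move=> [i _ [/= e]]; rewrite /output e.
Qed.

Lemma output_section_law x B : measurable B ->
  iid_law (proposal_law nu) ((fun z => output (x, z)) @^-1` B) =
  \int[nu]_(y in B) (f (x, y))%:E.
Proof.
apply: output_law => //.
- exact: (measurableT_comp measurable_output (measurable_pair1 x)).
- by move=> i w wi; rewrite /output (@stop_indexE i).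
Qed.

Lemma stop_index_section i x : measurable ((fun z => stop_index (x, z)) @^-1` [set i]).
Proof.
rewrite (_ : _ @^-1` _ = xsection (stop_index @^-1` [set i]) x).
  by apply: measurable_xsection; exact: measurable_stop_index.
by apply/seteqP; split => z; rewrite /xsection /= inE.
Qed.

Lemma stop_index_log_bound x (c : R) : (1 <= c)%R ->
  \sum_(i <oo) iid_law (proposal_law nu) ((fun z => stop_index (x, z)) @^-1` [set i])
     * (ln i.+1%:R)%:E + (ln c)%:E <=
  \int[nu]_y (f (x, y) * ln (1 + c * f (x, y)))%:E + (2 * ln 2 - 1 / 2)%:E.
Proof.
move=> c1; apply: (log_index_bound (v := fx x)) => //.
- move=> i; congr (iid_law _ _).
  rewrite (_ : _ @^-1` _ = xsection (stop_index @^-1` [set i.+1]) x).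
    by rewrite stop_indexS; apply/seteqP; split => z; rewrite /xsection /= inE.
  by apply/seteqP; split => z; rewrite /xsection /= inE.
- by rewrite measure_ge0 ltey_eq fin_num_measure//; exact: stop_index_section.
Qed.

Lemma output_joint_law (mu : probability X R) (A : set (X * Y)) : measurable A ->
  prodm mu (iid_law (proposal_law nu)) ((fun p => (p.1, output p)) @^-1` A) =
  \int[mu]_x \int[nu]_y ((f (x, y))%:E * (\1_A (x, y))%:E).
Proof.
move=> mA; apply: eq_integral => x _.
rewrite (_ : xsection _ x = (fun z => output (x, z)) @^-1` (xsection A x)).
  rewrite output_section_law; last exact: measurable_xsection.
  rewrite integral_mkcond; apply: eq_integral => y _; rewrite epatch_indic.
  by rewrite /= !indicE mem_xsection.
by apply/seteqP; split => z; rewrite /xsection /= !inE.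
Qed.

End joint_output.

(** * Integrating functions of an integer-valued variable *)

Section nat_valued.
Context {R : realType} {d : measure_display} {T : measurableType d}.
Variables (K : T -> nat) (w : nat -> R).
Hypothesis mK : forall i, measurable (K @^-1` [set i]).

Lemma measurable_nat_comp : measurable_fun setT (w \o K).
Proof.
move=> _ B mB; rewrite setTI.
rewrite (_ : _ @^-1` _ = \bigcup_(i in [set i | B (w i)]) (K @^-1` [set i])).
  by apply: bigcup_measurable => i _; exact: mK.
apply/seteqP; split => t /=; first by exists (K t).
by move=> [i /= Bi Kti]; rewrite Kti.
Qed.

Lemma integral_nat_comp (P : {measure set T -> \bar R}) : (forall i, 0 <= w i)%R ->
  \int[P]_t (w (K t))%:E = \sum_(i <oo) P (K @^-1` [set i]) * (w i)%:E.
Proof.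
move=> w0.
have term0 i t : 0 <= (\1_(K @^-1` [set i]) t)%:E * (w i)%:E by rewrite mule_ge0// lee_fin.
have mterm i : measurable_fun setT (fun t => (\1_(K @^-1` [set i]) t)%:E * (w i)%:E).
  by apply: emeasurable_funM => //; apply/measurable_EFinP; exact: measurable_indic.
transitivity (\int[P]_t \sum_(i <oo) ((\1_(K @^-1` [set i]) t)%:E * (w i)%:E)).
  apply: eq_integral => t _; rewrite (nneseriesD1 (n := K t))//.
  rewrite eseries0 ?adde0; last first.
    by move=> i _ /= iK; rewrite indicE memNset ?mul0e//= => Ki; rewrite Ki eqxx in iK.
  by rewrite indicE mem_set// mul1e.
rewrite integral_nneseries//; apply: eq_eseriesr => i _.
rewrite ge0_integralZr ?lee_fin//; last by apply/measurable_EFinP; exact: measurable_indic.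
by rewrite integral_indic// setIT.
Qed.

End nat_valued.

(** * From the mean log-index to conditional entropy *)

Section conditional_entropy.
Context {R : realType} {dX dY dZ : measure_display} {X : measurableType dX}
  {Y : measurableType dY} {Z : measurableType dZ}.
Variables (mu : probability X R) (PZ : probability Z R).
Variables (K : X * Z -> nat) (y : nat -> Z -> Y).
Hypothesis mK : forall i, measurable (K @^-1` [set i]).

(** For each [z] the output is coded through the index, with one code for all [z]. The expected code
    length is affine in the mean of [ln (K + 1)], and Tonelli passes from the average over [z] to
    the one over [x], where the hypothesis is available. *)
Lemma condH_index_le (a : R) : (0 < a)%R ->
  \int[mu]_x \int[PZ]_z (ln (K (x, z)).+1%:R)%:E <= (a * ln 2)%:E ->
  condH mu PZ (fun p => y (K p) p.2) <= (a + 1 + log2 (1 + a))%:E.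
Proof.
move=> a0 logK; pose t := a^-1%R; have t0 : (0 < t)%R by rewrite invr_gt0.
have l2 := @ln2_gt0 R.
have lnS i : (0 <= ln i.+1%:R :> R)%R by rewrite ln_ge0// ler1n.
have a1 : (0 < 1 + a)%R by lra.
(* coding the index by a zeta-like law, whose exponent [1 + 1 / a] is tuned to [a] *)
pose q i := (expR (- (1 + t) * ln i.+1%:R) / (1 + a))%R.
have q01 i : (0 < q i <= 1)%R.
  rewrite divr_gt0 ?expR_gt0//= ler_pdivrMr// mul1r.
  apply: (@le_trans _ _ 1%R); last by lra.
  by rewrite -[leRHS]expR0 ler_expR mulNr oppr_le0 mulr_ge0//; lra.
have sumq N : (\sum_(i < N) q i <= 1)%R.
  rewrite -mulr_suml ler_pdivrMr// mul1r.
  by have := zeta_partial_sum_le N t0; rewrite invrK.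
(* The code length is [alpha * ln (i + 1) + beta], and [alpha * (a * ln 2) = (1 + a^-1) * a = a +
   1]. *)
pose alpha := ((1 + t) / ln 2)%R; pose beta := log2 (1 + a).
have al0 : (0 <= alpha)%R by rewrite divr_ge0; lra.
have be0 : (0 <= beta)%R by rewrite divr_ge0 ?ln_ge0//; lra.
pose w i : R := (alpha * ln i.+1%:R + beta)%R.
have wE i : (- log2 (q i) = w i)%R.
  rewrite /log2 /q ln_div ?posrE ?expR_gt0// expRK /w /alpha /beta /log2.
  by field; rewrite gt_eqF.
have w0 i : (0 <= w i)%R by rewrite addr_ge0// mulr_ge0.
have mKz z i : measurable ((fun x => K (x, z)) @^-1` [set i]).
  rewrite (_ : _ @^-1` _ = ysection (K @^-1` [set i]) z).
    by apply: measurable_ysection.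
  by apply/seteqP; split => x; rewrite /ysection /= inE.
have mwK : measurable_fun setT (fun p => (w (K p))%:E).
  by apply/measurable_EFinP; exact: (measurable_nat_comp w mK).
have mlK : measurable_fun setT (fun p => (ln (K p).+1%:R : R)%:E).
  by apply/measurable_EFinP; exact: (measurable_nat_comp (fun i => ln i.+1%:R) mK).
apply: (@le_trans _ _ (\int[PZ]_z \int[mu]_x (w (K (x, z)))%:E)).
  apply: le_integral_nonmeasurable => z.
    by apply: integral_ge0 => x _; rewrite lee_fin.
  rewrite (integral_nat_comp (mKz z) mu w0).
  apply: (le_trans (Hdisc_le_cross_entropy mu (fun i => y i z) (mKz z) q01 sumq)).
  by rewrite (eq_eseriesr (fun i _ => congr1 (fun r => _ * r%:E) (wE i))).
rewrite -(fubini_tonelli (m1 := mu) (m2 := PZ) (fun p => (w (K p))%:E))//; last first.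
  by move=> p; rewrite lee_fin.
have -> : \int[mu]_x \int[PZ]_z (w (K (x, z)))%:E =
    alpha%:E * (\int[mu]_x \int[PZ]_z (ln (K (x, z)).+1%:R)%:E) + beta%:E.
  have mlx x : measurable_fun setT (fun z => (ln (K (x, z)).+1%:R : R)%:E).
    exact: (measurableT_comp mlK (measurable_pair1 x)).
  have int0 x : 0 <= \int[PZ]_z (ln (K (x, z)).+1%:R : R)%:E.
    by apply: integral_ge0 => z _; rewrite lee_fin.
  have mint : measurable_fun setT (fun x => \int[PZ]_z (ln (K (x, z)).+1%:R : R)%:E).
    by apply: (measurable_integral_section (k := fun p => (ln (K p).+1%:R : R)%:E)) => // p; rewrite lee_fin.
  transitivity (\int[mu]_x (alpha%:E * (\int[PZ]_z (ln (K (x, z)).+1%:R)%:E) + beta%:E)).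
    apply: eq_integral => x _.
    under eq_integral do rewrite /w EFinD EFinM.
    rewrite ge0_integralD//; last 2 first.
      by move=> z _; rewrite mule_ge0// lee_fin.
      exact: emeasurable_funM.
    rewrite ge0_integralZl ?lee_fin//; last by move=> z _; rewrite lee_fin.
    by rewrite (integral_cst PZ measurableT beta%:E) [X in _ + _ * X](probability_setT PZ) mule1.
  rewrite ge0_integralD//; last 2 first.
    by move=> x _; rewrite mule_ge0// lee_fin.
    exact: emeasurable_funM.
  rewrite ge0_integralZl ?lee_fin//.
  by rewrite (integral_cst mu measurableT beta%:E) [X in _ + _ * X](probability_setT mu) mule1.
apply: (@le_trans _ _ (alpha%:E * (a * ln 2)%:E + beta%:E)).
  by rewrite leeD2r// lee_wpmul2l// lee_fin.
rewrite -EFinM -EFinD lee_fin lerD2r /alpha /t.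
rewrite le_eqVlt; apply/orP; left; apply/eqP; field.
by rewrite !gt_eqF.
Qed.

End conditional_entropy.

(** * Assembly: one sampler for the whole ball and its entropy bound *)

Theorem theorem2 (R : realType) (dX dY : measure_display)
  (X : measurableType dX) (Y : measurableType dY)
  (hX : polish_borel (R := R) X) (hY : polish_borel (R := R) Y)
  (mu0 : probability X R) (Gamma : R) (hGamma : (0 <= Gamma)%R)
  (Q : R.-pker X ~> Y)
  (hfin : forall mu, KLball mu0 Gamma mu -> MI mu Q < +oo) :
  exists (dZ : measure_display) (Z : measurableType dZ)
         (PZ : probability Z R) (g : X * Z -> Y),
    measurable_fun [set: X * Z] g /\
    forall mu : probability X R, KLball mu0 Gamma mu ->
      (forall A : set (X * Y), measurable A ->
         prodm mu PZ ((fun p => (p.1, g p)) @^-1` A) = joint mu (fun x B => Q x B) A) /\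
      condH mu PZ g <=
        MIbar (KLball mu0 Gamma) Q + Gamma%:E
        + log2e (MIbar (KLball mu0 Gamma) Q + Gamma%:E + 1) + 4%:E.
Proof.
have l2 := @ln2_gt0 R.
have KL_fin (mu : probability X R) : KLball mu0 Gamma mu -> KL mu mu0 < +oo.
  by move=> /= h; apply: le_lt_trans h (ltry _).
have dom (mu : probability X R) : KLball mu0 Gamma mu ->
    forall N, measurable N -> mu0 N = 0 -> mu N = 0.
  by move=> /KL_fin h N mN; exact: KL_dominates.
(* This lets [hfin] be applied to [mu0] itself, and gives [0 <= I] below. *)
have ball0 : KLball mu0 Gamma mu0.
  by apply: (le_trans (KL_refl_le0 mu0)); rewrite lee_fin.
pose nu : probability Y R := marginal_law mu0 Q.
pose P2 : probability (X * Y)%type R := mu0 \x nu.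
have domJ A : measurable A -> P2 A = 0 -> joint_law mu0 Q A = 0.
  by move=> mA; apply: KL_dominates => //; exact: (hfin _ ball0).
have [f [mf f0 f1 dens]] := joint_density domJ.
have {}dens (mu : probability X R) : KLball mu0 Gamma mu -> joint_density_for mu0 Q f mu.
  by move=> /dom h; exact: dens.
pose PZ : probability _ R := iid_law (proposal_law nu).
exists _, _, PZ, (output nu f); split; first exact: measurable_output.
move=> mu muB; split.
  by move=> A mA; rewrite (output_joint_law mf f0 f1)// -(dens mu muB A mA).
set I := MIbar _ Q.
have I_ge mu' : KLball mu0 Gamma mu' -> MI mu' Q <= I.
  by move=> h; apply: ereal_sup_ubound; exists mu'.
have I0 : 0 <= I by apply: le_trans (I_ge _ ball0); exact: (KL_ge0 (joint_law mu0 Q) P2).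
(* If the supremum is infinite, so is the right side. *)
case: I I0 I_ge => [r| |] //; last first.
  move=> _ _; rewrite /= !addye// leey //.
rewrite lee_fin => r0 I_ge.
pose D : R := (r + Gamma)%R; have D0 : (0 <= D)%R by rewrite addr_ge0.
pose a : R := (D + 8 / 5)%R; have a0 : (0 < a)%R by rewrite /a; lra.
rewrite -!EFinD /= -/D.
apply: (@le_trans _ _ (a + 1 + log2 (1 + a))%:E); last first.
  by rewrite lee_fin log2_numeric_bound.
apply: (@condH_index_le _ _ _ _ _ _ _ mu PZ (stop_index nu f) (fun i z => (z i).1)) => //.
  exact: measurable_stop_index.
have c1 : (1 <= 20 :> R)%R by lra.
pose h x := \int[PZ]_z (ln (stop_index nu f (x, z)).+1%:R : R)%:E.
pose F x := \int[nu]_y (f (x, y) * ln (1 + 20 * f (x, y)))%:E.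
have C0 : (0 <= 2 * ln 2 - 1 / 2 :> R)%R.
  by have := @ln_le_subr1 R 2^-1 ltac:(lra); rewrite lnV ?posrE//; lra.
have hF x : h x + (ln 20)%:E <= F x + (2 * ln 2 - 1 / 2)%:E.
  rewrite /h (integral_nat_comp (w := fun i => ln i.+1%:R)
    (fun i => stop_index_section mf f0 f1 i x)); last by move=> i; rewrite ln_ge0// ler1n.
  exact: stop_index_log_bound.
have lnS i : (0 <= ln i.+1%:R :> R)%R by rewrite ln_ge0// ler1n.
have h0 x : 0 <= h x by apply: integral_ge0 => z _; rewrite lee_fin.
have fln0 p : (0 <= f p * ln (1 + 20 * f p))%R.
  by rewrite mulr_ge0// ln_ge0// lerDl mulr_ge0.
have F0 x : 0 <= F x by apply: integral_ge0 => y _; rewrite lee_fin.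
have mh : measurable_fun setT h.
  apply: (measurable_integral_section
    (k := fun p => (ln (stop_index nu f p).+1%:R : R)%:E)); last by move=> p; rewrite lee_fin.
  apply/measurable_EFinP.
  exact: (measurable_nat_comp (fun i => ln i.+1%:R) (measurable_stop_index mf f0 f1)).
have mF : measurable_fun setT F.
  apply: (measurable_integral_section
    (k := fun p => (f p * ln (1 + 20 * f p))%:E)); last by move=> p; rewrite lee_fin.
  apply/measurable_EFinP; apply: measurable_funM => //.
  apply: (measurableT_comp (@measurable_ln R)).
  by apply: measurable_funD => //; exact: measurable_funM.
have int_cst (k : R) : \int[mu]_x k%:E = k%:E.
  by rewrite [LHS](integral_cst mu measurableT k%:E) [X in _ * X](probability_setT mu) mule1.
have ln20 : (0 <= ln 20 :> R)%R by rewrite ln_ge0//; lra.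
have int_hF : \int[mu]_x h x + (ln 20)%:E <= \int[mu]_x F x + (2 * ln 2 - 1 / 2)%:E.
  rewrite -(int_cst (ln 20)) -(int_cst (2 * ln 2 - 1 / 2)%R) -!ge0_integralD//.
  apply: ge0_le_integral => //.
  - by move=> x _; rewrite adde_ge0 ?lee_fin.
  - exact: emeasurable_funD.
  - exact: emeasurable_funD.
have info := information_bound mf f0 f1 (dens _ ball0) (dens _ muB) (lt_le_trans ltr01 c1).
have {}info : \int[mu]_x F x <= (D * ln 2 + (ln (1 + 20) + 1 / 20))%:E.
  apply: (le_trans info); rewrite [leRHS]EFinD leeD2r// /D mulrDl EFinD !EFinM leeD//.
    by rewrite lee_wpmul2r// ?lee_fin ?(ltW l2)// I_ge.
  by rewrite lee_wpmul2r// lee_fin ltW.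
rewrite -(leeD2rE (x := (ln 20)%:E))//; apply: (le_trans int_hF).
apply: (le_trans (leeD2r _ info)); rewrite -!EFinD lee_fin.
have ln21 : (ln (1 + 20) <= ln 20 + 1 / 20 :> R)%R.
  have -> : (1 + 20 = 20 * (1 + 20^-1) :> R)%R by field.
  rewrite lnM ?posrE; [|lra|lra].
  by have := @ln_le_subr1 R (1 + 20^-1) ltac:(lra); lra.
(* The final comparison [2 * ln 2 - 1/2 + 1/10 <= 8/5 * ln 2] amounts to this. *)
have ln2_le1 : (ln 2 <= 1 :> R)%R by have := @ln_le_subr1 R 2 ltac:(lra); lra.
rewrite [(a * _)%R]mulrDl; move: (D * ln 2)%R ln21 ln2_le1 => u.
by move: (ln (1 + 20)) (ln 20) (ln 2) => u1 u2 u3; lra.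
Qed.
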